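(* Let $M$ be a compact closed Poisson manifold. If $\Phi$ is an element of the generalized center $D_0'(M)$ and $N\cap \operatorname{Supp}(\Phi)\neq\emptyset$ for some compact and closed symplectic leaf $N\subset M$, then $N\subset \operatorname{Supp}(\Phi)$.
   Context: $D'(M)$ is the space of distributions on $M$, i.e. the topological dual of $C^\infty(M)$. For $f\in C^\infty(M)$, $X_f$ is the Hamiltonian vector field, $X_f(g)=\{f,g\}$. For $\Phi\in D'(M)$, $\{f,\Phi\}\in D'(M)$ is defined by $\langle\{f,\Phi\},g\rangle=-\langle\Phi,\{f,g\}\rangle$. The generalized center is $D_0'(M)=\{\Phi\in D'(M) : \{f,\Phi\}=0\ \forall f\in C^\infty(M)\}$. For an open set $U\subset M$, the restriction of $\Phi\in D'(M)$ to $U$ is its restriction to the subspace of functions in $C^\infty(M)$ vanishing on $M\setminus U$. $\operatorname{Supp}(\Phi)$ is the set of points of $M$ having no open neighborhood to which the restriction of $\Phi$ is $0$. *)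

(* Defs.v *)
From HB Require Import structures.
From Stdlib Require Import Relation_Operators.
From mathcomp Require Import all_boot all_order all_algebra.
From mathcomp Require Import all_classical all_reals all_analysis.

Set Implicit Arguments.
Unset Strict Implicit.
Unset Printing Implicit Defensive.

Import Order.TTheory GRing.Theory Num.Theory.
Import numFieldNormedType.Exports.

Local Open Scope classical_set_scope.
Local Open Scope ring_scope.

Section SmoothEuclidean.
Context {R : realType} {n : nat}.
Implicit Types (U : set 'rV[R]_n) (f g : 'rV[R]_n -> R) (s : seq 'I_n).

Definition partial (i : 'I_n) f : 'rV[R]_n -> R :=
  fun x => 'D_('e_i) f x.

(* partials [:: i1; ...; ik] f is the derivative of f along i1, then i2, ... *)
Definition partials s f := foldl (fun h i => partial i h) f s.

Definition C1_data U f := forall x, U x ->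
  {for x, continuous f} /\ forall i, derivable f x ('e_i).

Definition smooth_on U f := forall s, C1_data U (partials s f).

Definition Cupto U (k : nat) f :=
  forall s, (size s <= k)%N -> C1_data U (partials s f).

Lemma CuptoS U k f : C1_data U f -> (forall i, Cupto U k (partial i f)) ->
  Cupto U k.+1 f.
Proof. by move=> f0 fk [|i s] //= sk; apply: fk. Qed.

Lemma Cupto_partial U k f i : Cupto U k.+1 f -> Cupto U k (partial i f).
Proof. by move=> fk s sk; apply: (fk (i :: s)). Qed.

Lemma smooth_on_partial U f i : smooth_on U f -> smooth_on U (partial i f).
Proof. by move=> fk s; apply: (fk (i :: s)). Qed.

Lemma smooth_onP U f : smooth_on U f <-> forall k, Cupto U k f.
Proof. by split=> [fU k s _|fU s]; [exact: fU|exact: (fU (size s))]. Qed.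

Lemma near_open U f g : open U -> {in U, f =1 g} ->
  forall x, U x -> \forall y \near x, f y = g y.
Proof.
move=> oU fg x Ux; have : nbhs x U by exact: open_nbhs_nbhs.
by apply: filterS => y Uy; apply: fg; rewrite inE.
Qed.

Lemma eq_C1_data U f g : open U -> {in U, f =1 g} ->
  C1_data U f -> C1_data U g.
Proof.
move=> oU fg f1 x Ux; have [fc fd] := f1 x Ux.
have nfg := near_open oU fg Ux; split=> [|i].
  rewrite /prop_for /continuous_at -(fg x) ?inE//.
  exact: cvg_trans (near_eq_cvg nfg) fc.
apply: (near_eq_derivable _ (fd i)); first exact: nfg.
Qed.

Lemma eq_partial U f g i : open U -> {in U, f =1 g} ->
  {in U, partial i f =1 partial i g}.
Proof.
move=> oU fg x; rewrite inE => Ux.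
apply: near_eq_derive; first exact: (near_open oU fg Ux).
Qed.

Lemma eq_Cupto U k f g : open U -> {in U, f =1 g} -> Cupto U k f -> Cupto U k g.
Proof.
move=> oU; elim: k f g => [|k IH] f g fg fk.
  by case=> // _; apply: eq_C1_data fg _ => //; exact: (fk [::]).
apply: CuptoS; first by apply: eq_C1_data fg _ => //; exact: (fk [::]).
move=> i; apply: IH (eq_partial i oU fg) _; exact: Cupto_partial.
Qed.


Lemma C1_dataD U f g : C1_data U f -> C1_data U g -> C1_data U (f + g).
Proof.
move=> fU gU x Ux; have [fc fd] := fU x Ux; have [gc gd] := gU x Ux.
by split=> [|i]; [exact: continuousD|exact: derivableD].
Qed.

Lemma C1_dataM U f g : C1_data U f -> C1_data U g -> C1_data U (f * g).
Proof.
move=> fU gU x Ux; have [fc fd] := fU x Ux; have [gc gd] := gU x Ux.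
by split=> [|i]; [exact: continuousM|exact: derivableM].
Qed.

Lemma CuptoD U k f g : open U -> Cupto U k f -> Cupto U k g ->
  Cupto U k (f + g).
Proof.
move=> oU; elim: k f g => [|k IH] f g fU gU.
  by case=> // _; apply: C1_dataD; [exact: (fU [::])|exact: (gU [::])].
apply: CuptoS => [|i].
  by apply: C1_dataD; [exact: (fU [::])|exact: (gU [::])].
apply: (@eq_Cupto _ _ (partial i f + partial i g)) => // [x|].
  rewrite inE => Ux; rewrite /partial deriveD//.
  - by have [] := fU [::] isT x Ux.
  - by have [] := gU [::] isT x Ux.
by apply: IH; exact: Cupto_partial.
Qed.

Lemma smooth_onD U f g : open U -> smooth_on U f -> smooth_on U g ->
  smooth_on U (f + g).
Proof.
by move=> oU /smooth_onP fU /smooth_onP gU; apply/smooth_onP => k; exact: CuptoD.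
Qed.

Lemma smooth_onM U f g : open U -> smooth_on U f -> smooth_on U g ->
  smooth_on U (f * g).
Proof.
move=> oU fU gU; apply/smooth_onP => k; elim: k f g fU gU => [|k IH] f g fU gU.
  by case=> // _; apply: C1_dataM; [exact: (fU [::])|exact: (gU [::])].
apply: CuptoS => [|i].
  by apply: C1_dataM; [exact: (fU [::])|exact: (gU [::])].
apply: (@eq_Cupto _ _ (f * partial i g + g * partial i f)) => // [x|].
  rewrite inE => Ux; rewrite /partial deriveM//.
  - by have [] := fU [::] x Ux.
  - by have [] := gU [::] x Ux.
by apply: CuptoD => //; apply: IH => //; exact: smooth_on_partial.
Qed.

Lemma smooth_on_cst U (c : R) : open U -> smooth_on U (cst c).
Proof.
move=> oU; apply/smooth_onP => k; elim: k c => [|k IH] c.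
  case=> // _ x Ux; split=> [|i]; [exact: cst_continuous|exact: derivable_cst].
apply: CuptoS => [x Ux|i].
  by split=> [|i]; [exact: cst_continuous|exact: derivable_cst].
apply: (@eq_Cupto _ _ (cst 0)) => // x _.
by rewrite /partial derive_cst.
Qed.

End SmoothEuclidean.

(* A chart is a homeomorphism chart_map, with inverse chart_inv, from the open
   set chart_dom onto an open subset of R^n; the values of chart_map and
   chart_inv outside these two open sets are irrelevant. *)
Record chart (R : realType) (n : nat) (M : topologicalType) := Chart {
  chart_dom : set M;
  chart_map : M -> 'rV[R]_n;
  chart_inv : 'rV[R]_n -> M;
  chart_dom_open : open chart_dom;
  chart_im_open : open (chart_map @` chart_dom);
  chart_mapK : {in chart_dom, cancel chart_map chart_inv};
  chart_map_continuous : {in chart_dom, continuous chart_map};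
  chart_inv_continuous : {in chart_map @` chart_dom, continuous chart_inv}
}.

Definition chart_im (R : realType) (n : nat) (M : topologicalType)
  (c : chart R n M) : set 'rV[R]_n := chart_map c @` chart_dom c.

Definition smooth_transition (R : realType) (n : nat) (M : topologicalType)
    (c d : chart R n M) :=
  forall i : 'I_n, smooth_on (chart_map c @` (chart_dom c `&` chart_dom d))
    (fun x => chart_map d (chart_inv c x) 0 i).

Record smooth_manifold (R : realType) (n : nat) := SmoothManifold {
  mfd_space :> topologicalType;
  mfd_hausdorff : hausdorff_space mfd_space;
  mfd_second_countable : @second_countable mfd_space;
  mfd_atlas : set (chart R n mfd_space);
  mfd_cover : \bigcup_(c in mfd_atlas) chart_dom c = setT;
  mfd_compatible : forall c d, mfd_atlas c -> mfd_atlas d ->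
    smooth_transition c d
}.

Section SmoothFunctions.
Context {R : realType} {n : nat} (M : smooth_manifold R n).

Definition smooth (f : M -> R) :=
  forall c, mfd_atlas c -> smooth_on (chart_im c) (f \o chart_inv c).

Definition smooth_pred : {pred M -> R} := fun f => `[< smooth f >].

Lemma smooth_subring : subring_closed smooth_pred.
Proof.
have sM f g : f \in smooth_pred -> g \in smooth_pred -> f * g \in smooth_pred.
  move=> /asboolP fM /asboolP gM; apply/asboolP => c Mc.
  rewrite -[_ \o _]/((f \o chart_inv c) * (g \o chart_inv c)).
  exact: smooth_onM (@chart_im_open _ _ _ c) (fM c Mc) (gM c Mc).
have scst (a : R) : cst a \in smooth_pred.
  by apply/asboolP => c _; exact: smooth_on_cst (@chart_im_open _ _ _ c).
split=> [|f g fM gM|//]; first exact: scst.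
have -> : f - g = f + cst (-1) * g.
  by apply/funext => x; rewrite /GRing.add/GRing.mul/GRing.opp/= mulN1r.
have /asboolP NgM := sM _ _ (scst (-1)) gM; move: fM => /asboolP fM.
apply/asboolP => c Mc.
rewrite -[_ \o _]/((f \o chart_inv c) + ((cst (-1) * g) \o chart_inv c)).
exact: smooth_onD (@chart_im_open _ _ _ c) (fM c Mc) (NgM c Mc).
Qed.

Lemma smooth_scaler : GRing.scaler_closed smooth_pred.
Proof.
move=> a f /asboolP fM; apply/asboolP => c Mc.
rewrite -[_ \o _]/(cst a * (f \o chart_inv c)).
apply: smooth_onM (@chart_im_open _ _ _ c) _ (fM c Mc).
exact: smooth_on_cst (@chart_im_open _ _ _ c).
Qed.

HB.instance Definition _ :=
  GRing.isSubringClosed.Build (M -> R) smooth_pred smooth_subring.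
HB.instance Definition _ :=
  GRing.isScaleClosed.Build R (M -> R) smooth_pred smooth_scaler.

Record Cinfty := MkCinfty {
  Cinfty_fun :> M -> R;
  _ : Cinfty_fun \in smooth_pred
}.

HB.instance Definition _ := [isSub for Cinfty_fun].
HB.instance Definition _ := [Choice of Cinfty by <:].
HB.instance Definition _ :=
  GRing.SubChoice_isSubComPzRing.Build (M -> R) smooth_pred Cinfty
    (GRing.subringClosedP _).
HB.instance Definition _ := [SubZmodule_isSubLmodule of Cinfty by <:].

(* The C^infinity topology is the topology of uniform convergence, on compact
   subsets of the images of the charts, of all iterated partial derivatives of
   the local expressions. *)
Definition chart_compacts (c : chart R n M) : set 'rV[R]_n -> Prop :=
  fun K => compact K /\ K `<=` chart_im c.

Definition jet_space (j : {c | mfd_atlas c} * seq 'I_n) : topologicalType :=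
  {family chart_compacts (projT1 j.1), 'rV[R]_n -> R}.

Definition jet (f : Cinfty) : prod_topology jet_space :=
  fun j => partials j.2 (f \o chart_inv (projT1 j.1)).

HB.instance Definition _ := Topological.copy Cinfty (initial_topology jet).

Record smooth_distribution := SmoothDistribution {
  distribution_fun :> {linear Cinfty -> R^o};
  distribution_continuous : continuous distribution_fun
}.

Definition restriction_eq0 (Phi : smooth_distribution) (U : set M) :=
  forall g : Cinfty, (forall x, ~ U x -> g x = 0) -> Phi g = 0.

Definition Supp (Phi : smooth_distribution) : set M :=
  [set x | ~ exists U, [/\ open U, U x & restriction_eq0 Phi U]].

End SmoothFunctions.

Record poisson_manifold (R : realType) (n : nat) := PoissonManifold {
  poisson_mfd :> smooth_manifold R n;
  bracket : Cinfty poisson_mfd -> Cinfty poisson_mfd -> Cinfty poisson_mfd;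
  bracket_linear : forall f, linear (bracket f);
  bracket_anti : forall f g, bracket f g = - bracket g f;
  bracket_leibniz : forall f g h,
    bracket f (g * h) = bracket f g * h + g * bracket f h;
  bracket_jacobi : forall f g h,
    bracket f (bracket g h) + bracket g (bracket h f) +
    bracket h (bracket f g) = 0
}.

Section Poisson.
Context {R : realType} {n : nat} (M : poisson_manifold R n).

Definition hamiltonian_field (f : Cinfty M) : Cinfty M -> Cinfty M :=
  fun g => bracket f g.

(* {f, Phi} is again continuous because derivations of C^infinity(M) are; as only
   its vanishing is used, it is kept as a bare functional. *)
Definition bracket_distribution (f : Cinfty M) (Phi : smooth_distribution M) :
  Cinfty M -> R := fun g => - Phi (bracket f g).

Definition generalized_center : set (smooth_distribution M) :=
  [set Phi | forall f, bracket_distribution f Phi = cst 0].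

(* Tangent vectors act as derivations: gamma' = X_f(gamma) is tested against all
   smooth functions. *)
Definition integral_curve (f : Cinfty M) (a b : R) (gamma : R -> M) :=
  forall t, t \in `]a, b[ -> {for t, continuous gamma} /\
    forall g : Cinfty M, is_derive t 1 (g \o gamma : R -> R)
      (hamiltonian_field f g (gamma t)).

Definition hamiltonian_path (x y : M) := exists f a b gamma s t,
  [/\ integral_curve f a b gamma, s \in `]a, b[, t \in `]a, b[,
      gamma s = x & gamma t = y].

(* Symplectic leaves are the classes of the relation "joined by finitely many
   consecutive pieces of integral curves of Hamiltonian vector fields"; since
   hamiltonian_path is symmetric, so is its reflexive transitive closure. *)
Definition symplectic_leaf (N : set M) :=
  exists x, N = [set y | clos_refl_trans M hamiltonian_path x y].

End Poisson.

(* Main.v *)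
Require Import Defs.
From Stdlib Require Import Relation_Operators.
From HB Require Import structures.
From mathcomp Require Import all_boot all_order all_algebra.
From mathcomp Require Import all_classical all_reals all_analysis.
From mathcomp Require Import ring lra.

Set Implicit Arguments.
Unset Strict Implicit.
Unset Printing Implicit Defensive.
Import Order.TTheory GRing.Theory Num.Theory.
Import numFieldNormedType.Exports.
Local Open Scope classical_set_scope.
Local Open Scope ring_scope.

(** A symplectic leaf is swept out by integral curves of Hamiltonian vector
    fields, so the claim is that the support of an element Phi of the
    generalized center is constant along every such curve.  For the flow phi_t
    of X_f this would be the invariance <Phi, g o phi_t> = <Phi, g>, because the
    derivative in t is <Phi, {f, g o phi_t}> = 0.  The proof below uses no flow:
    the flow is replaced by iterates of an Euler step, in one chart at a time.

    Let a be the vector field X_f read in a chart and E(x) = x + t a(x) an Euler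
    step.  One step changes the pairing with Phi very little: g o E - g is
    t X_f(g), which Phi kills, up to an error whose partial derivatives of every
    order are O(t^2) ([euler_remainder_bound]).  Composing with E multiplies the
    bounds on the partial derivatives of order at most r by 1 + O(t)
    ([euler_bound]), so that these bounds stay under control along T / t steps,
    and the errors accumulated over a fixed time T are O(t) in every C^r norm
    ([scheme_defect_bound]).  Hence they tend to 0 in the C^infinity topology,
    and continuity of Phi gives <Phi, g o E^m> -> <Phi, g> with t = T / m.

    Now take g supported near the point y(s) of an integral curve y.  Euler's
    method is stable and consistent, so g o E^m, with m t = s - s', is supported
    near y(s') as soon as m is large ([euler_tracking]).  If y(s') is not in the
    support of Phi, then <Phi, g o E^m> = 0 for all large m, whence
    <Phi, g> = 0: y(s) is not in the support either ([transport_in_chart]).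
    This makes the support locally constant along the curve, and an interval is
    connected.

    That X_f has smooth coefficients in a chart is a fact about derivations of
    the ring of smooth functions on M, which are assumed to be linear but not
    continuous: they are local by multiplication with a bump function, and
    Hadamard's lemma reduces them to their values on the coordinates
    ([derivation_clift]). *)

(** * Calculus from partial derivatives *)

Lemma cvg_sumr (R : realType) (T : Type) (F : set_system T) {FF : Filter F}
    (I : Type) (s : seq I) (f : I -> T -> R) (a : I -> R) :
  (forall i, f i x @[x --> F] --> a i) ->
  (\sum_(i <- s) f i x) @[x --> F] --> \sum_(i <- s) a i.
Proof.
by move=> fa; apply: cvg_big => [|i _]; [exact: add_continuous|exact: fa].
Qed.

Section DeriveLine.
Context {R : realType}.

(** Reduces directional derivatives to derivatives of functions of one real
    variable, where the usual chain rule applies. *)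
Lemma is_derive_line (W Z : normedModType R) (F : W -> Z) (x v : W) (d : Z) :
  is_derive x v F d <-> is_derive (0 : R) (1 : R) (fun h : R => F (h *: v + x)) d.
Proof.
have E : (fun h : R => h^-1 *: ((F \o shift x) (h *: v) - F x)) =
    (fun h : R => h^-1 *: (((fun h : R => F (h *: v + x)) \o shift 0) (h *: (1 : R))
                           - F (0 *: v + x))).
  by apply/funext => h /=; rewrite addr0 scale0r add0r [_%:A]mulr1.
by split=> -[dF <-]; split; move: dF; rewrite /derivable /derive E.
Qed.

End DeriveLine.

Section Calculus.
Context {R : realType} {n : nat}.
Implicit Types (f g : 'rV[R]_n -> R) (x y h : 'rV[R]_n).

Lemma ler_norm_coord x i : `|x 0 i| <= `|x|.
Proof.
by rewrite [leRHS]/Num.Def.normr/= mx_normrE (le_bigmax _ _ (0, i)).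
Qed.

Lemma rV_norm_le x (r : R) : 0 <= r -> (forall i, `|x 0 i| <= r) -> `|x| <= r.
Proof.
move=> r0 xr; rewrite [leLHS]/Num.Def.normr/= mx_normrE (bigmax_le _ r0)//=.
by move=> [i j] _; rewrite ord1.
Qed.

Lemma rV_norm_lt x (r : R) : 0 < r -> (forall i, `|x 0 i| < r) -> `|x| < r.
Proof.
move=> r0 xr; rewrite [ltLHS]/Num.Def.normr/= mx_normrE; apply/bigmax_ltP.
by split=> //= -[i j] _; rewrite ord1.
Qed.

Lemma norm_e_le1 i : `|('e_i : 'rV[R]_n)| <= 1.
Proof.
apply: rV_norm_le => // j; rewrite mxE eqxx /=.
by case: eqP => _; rewrite ?normr1 ?normr0.
Qed.

Lemma line_derive f z i (t : R) : derivable f (z + t *: 'e_i) ('e_i) ->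
  is_derive t (1:R) (fun s : R => f (z + s *: 'e_i)) (partial i f (z + t *: 'e_i)).
Proof.
move=> fd; have := derivableP fd; rewrite -/(partial i f _) => -[] dd de.
have E : (fun h : R => h^-1 *:
    (((fun s : R => f (z + s *: 'e_i)) \o shift t) (h *: (1:R)) - f (z + t *: 'e_i)))
  = (fun h : R => h^-1 *: ((f \o shift (z + t *: 'e_i)) (h *: 'e_i) - f (z + t *: 'e_i))).
  apply/funext => h /=; congr (_ *: (f _ - _)).
  by rewrite [_%:A]mulr1 scalerDl addrCA.
by split; rewrite /derivable /derive E.
Qed.

Lemma line_increment f z i (a eps s : R) :
  (forall t : R, `|t| <= `|s| ->
     derivable f (z + t *: 'e_i) ('e_i) /\
     `|partial i f (z + t *: 'e_i) - a| <= eps) ->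
  `|f (z + s *: 'e_i) - f z - a * s| <= eps * `|s|.
Proof.
move=> H.
pose phi (t : R) := f (z + (t * s) *: 'e_i).
have phid (t : R) : 0 <= t <= 1 -> is_derive t (1:R) phi (partial i f (z + (t * s) *: 'e_i) * s).
  move=> /andP[t0 t1].
  have ts : `|t * s| <= `|s| by rewrite normrM ger0_norm// ler_piMl.
  have [+ _] := H _ ts => /line_derive hd.
  have -> : phi = (fun u : R => f (z + u *: 'e_i)) \o (fun t => t * s) by [].
  have hs : is_derive t (1:R) (fun t : R => t * s) s.
    by apply: is_derive_eq; rewrite scaler0 add0r /GRing.scale /= mulr1.
  exact: is_derive1_comp.
have [||c c01] := @MVT_segment R phi (fun t => partial i f (z + (t * s) *: 'e_i) * s) 0 1 ler01 _ _.
- by move=> t /[!in_itv]/= /andP[t0 t1]; apply: phid; rewrite !ltW.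
- apply: derivable_within_continuous => t /[!in_itv]/= t01.
  by have [] := phid t t01.
rewrite /phi mul1r mul0r scale0r addr0 subr0 mulr1 => ->.
move: c01 => /[!in_itv]/= /andP[c0 c1].
rewrite -mulrBl normrM ler_wpM2r//.
by have [] := H (c * s); first by rewrite normrM ger0_norm// ler_piMl.
Qed.

Definition rtrunc (k : nat) h : 'rV[R]_n := \row_i (if (i < k)%N then h 0 i else 0).

Lemma rtruncS k h (kn : (k < n)%N) :
  rtrunc k.+1 h = rtrunc k h + h 0 (Ordinal kn) *: 'e_(Ordinal kn).
Proof.
apply/rowP => i; rewrite !mxE eqxx/= ltnS leq_eqVlt -val_eqE/=.
case: eqVneq => [ik|] /=.
  have -> : i = Ordinal kn by apply/val_inj.
  by rewrite ltnn add0r mulr1.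
by rewrite mulr0 addr0.
Qed.

Lemma rtrunc_n h : rtrunc n h = h.
Proof. by apply/rowP => i; rewrite mxE ltn_ord. Qed.

Lemma rtrunc_0 h : rtrunc 0 h = 0.
Proof. by apply/rowP => i; rewrite !mxE. Qed.

(** The increment along h is the sum of n increments along the coordinate axes,
    to each of which the mean value theorem applies.  The numbers a i are left
    free: they are the partial derivatives at x in a first order expansion, and
    0 in a Lipschitz bound. *)
Lemma C1_increment f x (r eps : R) (a : 'I_n -> R) :
  (forall y, `|y - x| < r -> forall i, derivable f y ('e_i) /\
     `|partial i f y - a i| <= eps) ->
  forall h, `|h| < r ->
    `|f (x + h) - f x - \sum_i a i * h 0 i| <= eps * n%:R * `|h|.
Proof.
move=> H h hr.
have eps0 : (0 < n)%N -> 0 <= eps.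
  move=> n0; have [|_] := H x _ (Ordinal n0); last exact: le_trans.
  by rewrite subrr normr0 (le_lt_trans _ hr).
(* change the coordinates of x into those of x + h one after the other *)
suff G k : (k <= n)%N -> `|f (x + rtrunc k h) - f x - \sum_(i < n | (i < k)%N) a i * h 0 i|
    <= eps * k%:R * `|h|.
  have := G n (leqnn n); rewrite rtrunc_n.
  by under eq_bigl do rewrite ltn_ord.
elim: k => [_|k IH kn].
  by rewrite rtrunc_0 addr0 subrr big_pred0 // subr0 normr0 mulr0 mul0r.
rewrite (rtruncS _ kn) (bigD1 (Ordinal kn)) ?ltnSn//=.
rewrite (eq_bigl (fun i : 'I_n => (i < k)%N)); last first.
  move=> i; rewrite ltnS -val_eqE/=; case: ltngtP => //.
set z := x + rtrunc k h; set j := Ordinal kn; set s := h 0 j.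
rewrite [x + _]addrA -/z.
have := IH (ltnW kn); rewrite -/z; set S := \sum_(i | _) _ => IHk.
have L : `|f (z + s *: 'e_j) - f z - a j * s| <= eps * `|s|.
  apply: line_increment => t ts; apply: H; rewrite /z.
  have -> : x + rtrunc k h + t *: 'e_j - x = rtrunc k h + t *: 'e_j.
    by rewrite -[x + _ + _]addrA [x + _]addrC addrK.
  apply: le_lt_trans hr; apply: rV_norm_le => // i; rewrite !mxE eqxx/=.
  case: (eqVneq i j) => [->|ij]; rewrite ?eqxx /=.
    by rewrite ltnn add0r mulr1 (le_trans ts)// ler_norm_coord.
  rewrite mulr0 addr0; case: ifP => _; rewrite ?normr0//; exact: ler_norm_coord.
have -> : f (z + s *: 'e_j) - f x - (a j * s + S) =
   (f (z + s *: 'e_j) - f z - a j * s) + (f z - f x - S) by ring.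
rewrite (le_trans (ler_normD _ _))// -[k.+1%:R]natr1 mulrDr mulr1 mulrDl addrC lerD//.
rewrite (le_trans L)// ler_wpM2l ?ler_norm_coord//.
by rewrite eps0// (leq_ltn_trans _ kn).
Qed.


(** Continuity of the partial derivatives makes the bound of [C1_increment] a
    little o of h.  This is the bridge from the notion of smoothness used here,
    which speaks of partial derivatives only, to total differentials. *)
Lemma C1_differentiable f (U : set 'rV[R]_n) x : open U -> U x -> Cupto U 1 f ->
  differentiable f x /\ forall h, 'd f x h = \sum_i h 0 i * partial i f x.
Proof.
move=> oU Ux fU.
pose L : 'rV[R]_n -> R := fun h => \sum_i h 0 i * partial i f x.
have L_lin : linear L.
  move=> k u v; rewrite /L scaler_sumr -big_split/=; apply: eq_bigr => i _.
  by rewrite !mxE mulrDl -mulrA.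
pose LL := GRing.isLinear.Build _ _ _ _ L L_lin.
pose Lf : {linear 'rV[R]_n -> R} := HB.pack L LL.
have Lc : continuous Lf.
  move=> y; rewrite /= /L; apply: (@cvg_sumr _ _ (nbhs y)) => i; apply: cvgMr_tmp.
  exact: coord_continuous.
have K (e : R) : 0 < e ->
    \forall h \near (0 : 'rV[R]_n), `|f (h + x) - (f x + L h)| <= e * `|h|.
  move=> e0.
  have e'0 : 0 < e / n.+1%:R by rewrite divr_gt0.
  have nU : nbhs x U by exact: open_nbhs_nbhs.
  have [r r0 Hr] : exists2 r : R, 0 < r &
     forall y, `|y - x| < r -> forall i, derivable f y ('e_i) /\
     `|partial i f y - partial i f x| <= e / n.+1%:R.
    have : \forall y \near x, forall i, derivable f y ('e_i) /\
     `|partial i f y - partial i f x| <= e / n.+1%:R.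
      near=> y; near: y; apply: filter_forall => /= i; near=> y; split.
        have Uy : U y by near: y.
        by have [_ ] := fU [::] isT y Uy.
      near: y.
      have [/cvgrPdist_le/(_ _ e'0) C _] := fU [:: i] isT x Ux.
      by near do rewrite distrC.
    move=> /nbhs_ballP[r /= r0 Hr]; exists r => // y yr; apply: Hr.
    by rewrite -ball_normE /= distrC.
  have N : \forall h \near (0 : 'rV[R]_n), `|h| < r by exact: nbhs0_lt.
  near=> h.
  have := C1_increment Hr (h := h); rewrite /=.
  have hr : `|h| < r by near: h.
  move=> /(_ hr); rewrite [x + h]addrC opprD addrA.
  rewrite (_ : \sum_i _ = L h); last by apply: eq_bigr => i _; rewrite mulrC.
  move=> /le_trans; apply; rewrite ler_wpM2r// -mulrA ler_piMr ?ltW//.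
  by rewrite ltr_pdivrMl// mulr1 ltr_nat.
have E : 'd f x = Lf :> ('rV[R]_n -> R).
  by apply: diff_unique => //; apply/eqaddoP => e e0; exact: K.
split; last by move=> h; rewrite E.
apply/diff_locallyP; rewrite E; split => //.
by apply/eqaddoP => e e0; exact: K.
Unshelve. all: by end_near. Qed.

End Calculus.

Section Chain.
Context {R : realType} {n : nat}.

(** Stated for a map psi out of any normed space, to serve both for changes of
    coordinates and for curves. *)
Lemma chain_is_derive (W : normedModType R) (psi : W -> 'rV[R]_n)
    (g : 'rV[R]_n -> R) (V : set 'rV[R]_n) (x v : W) (d : 'I_n -> R) :
  open V -> V (psi x) -> Cupto V 1 g ->
  (forall j, is_derive x v (fun y => psi y 0 j) (d j)) ->
  is_derive x v (g \o psi) (\sum_j d j * partial j g (psi x)).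
Proof.
move=> oV Vx gV psid; apply/is_derive_line.
pose phi (h : R) := psi (h *: v + x).
have phi0 : phi 0 = psi x by rewrite /phi scale0r add0r.
have phid j : is_derive (0 : R) (1 : R) (fun h => phi h 0 j) (d j).
  exact/(is_derive_line (fun y => psi y 0 j)).
have dphi : derivable phi (0 : R) 1.
  by apply/derivable_mxP => i j; rewrite ord1; have [] := phid j.
have dphi' : differentiable phi 0 by apply/derivable1_diffP.
have [dg gE] := C1_differentiable oV Vx gV.
have dg' : differentiable g (phi 0) by rewrite phi0.
have dgphi := @differentiable_comp _ _ _ _ phi g 0 dphi' dg'.
split; first exact/(derivable1_diffP (g \o phi)).
transitivity ('d (g \o phi) (0 : R) (1 : R)); first exact: (deriveE _ dgphi).
rewrite (diff_comp dphi' dg') [LHS]/= phi0 gE.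
apply: eq_bigr => j _; congr (_ * _).
rewrite -(deriveE (1 : R) dphi') (derive_mx dphi) mxE.
by have [_ ->] := phid j.
Qed.

Lemma continuous_row (T : topologicalType) (psi : T -> 'rV[R]_n) (x : T) :
  (forall j, {for x, continuous (fun y => psi y 0 j)}) ->
  {for x, continuous psi}.
Proof.
move=> H; apply/cvgrPdist_lt => e e0.
have F : \forall t \near x, forall j, `|psi x 0 j - psi t 0 j| < e.
  near=> t; near: t; apply: filter_forall => /= j.
  by have /cvgrPdist_lt/(_ _ e0) := H j.
near=> t; apply: rV_norm_lt => // j; rewrite !mxE.
by move: j; near: t.
Unshelve. all: by end_near. Qed.

End Chain.

Section SmoothToolkit.
Context {R : realType} {n : nat}.
Implicit Types (U V : set 'rV[R]_n) (f g : 'rV[R]_n -> R).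

Lemma Cupto_leq U k l f : (k <= l)%N -> Cupto U l f -> Cupto U k f.
Proof. by move=> kl fU s sk; apply: fU; exact: leq_trans kl. Qed.

Lemma smooth_Cupto U k f : smooth_on U f -> Cupto U k f.
Proof. by move=> /smooth_onP. Qed.

Lemma smooth_on_subset U V f : U `<=` V -> smooth_on V f -> smooth_on U f.
Proof. by move=> UV fV s x /UV Vx; exact: fV. Qed.

Lemma eq_smooth_on U f g : open U -> {in U, f =1 g} ->
  smooth_on U f -> smooth_on U g.
Proof.
by move=> oU fg /smooth_onP fU; apply/smooth_onP => k; exact: eq_Cupto fg _.
Qed.

Lemma smooth_on_local U f :
  (forall x, U x -> exists V, [/\ open V, V x & smooth_on V f]) ->
  smooth_on U f.
Proof. by move=> H s x Ux; have [V [_ Vx fV]] := H x Ux; exact: fV. Qed.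

Lemma CuptoM U k f g : open U -> Cupto U k f -> Cupto U k g ->
  Cupto U k (fun x => f x * g x).
Proof.
move=> oU; elim: k f g => [|k IH] f g fU gU.
  by case=> // _; apply: C1_dataM; [exact: (fU [::])|exact: (gU [::])].
apply: CuptoS => [|i].
  by apply: C1_dataM; [exact: (fU [::])|exact: (gU [::])].
have fUk := Cupto_leq (leqnSn k) fU; have gUk := Cupto_leq (leqnSn k) gU.
have E : {in U, (fun x => f x * partial i g x) + (fun x => g x * partial i f x)
    =1 partial i (fun x => f x * g x)}.
  move=> x /[!inE] Ux; have [_ /(_ i) df] := fU [::] isT x Ux.
  have [_ /(_ i) dg] := gU [::] isT x Ux.
  exact: esym (deriveM df dg).
apply: (eq_Cupto oU E).
exact: (CuptoD oU (IH _ _ fUk (Cupto_partial i gU)) (IH _ _ gUk (Cupto_partial i fU))).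
Qed.

Lemma Cupto_cst U k (c : R) : open U -> Cupto U k (fun=> c).
Proof. by move=> oU; have /smooth_onP := smooth_on_cst c oU; exact. Qed.

Lemma Cupto_sum U k (I : finType) (F : I -> 'rV[R]_n -> R) : open U ->
  (forall i, Cupto U k (F i)) -> Cupto U k (fun x => \sum_i F i x).
Proof.
move=> oU FU; rewrite (_ : (fun _ => _) = \sum_i F i); last first.
  by apply/funext => x; rewrite fct_sumE.
elim/big_ind: _ => [|f g fU gU|i _]; [exact: (Cupto_cst 0 oU)|exact: CuptoD|exact: FU].
Qed.

Lemma partialM U f g i : C1_data U f -> C1_data U g ->
  {in U, partial i (fun x => f x * g x) =1
         (fun x => partial i f x * g x + f x * partial i g x)}.
Proof.
move=> fU gU x; rewrite inE => Ux.
have [_ /(_ i) df] := fU x Ux; have [_ /(_ i) dg] := gU x Ux.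
rewrite [LHS](deriveM df dg) addrC; congr (_ + _); exact: mulrC.
Qed.

Lemma partialD U f g i : C1_data U f -> C1_data U g ->
  {in U, partial i (fun x => f x + g x) =1 (fun x => partial i f x + partial i g x)}.
Proof.
move=> fU gU x; rewrite inE => Ux.
have [_ /(_ i) df] := fU x Ux; have [_ /(_ i) dg] := gU x Ux.
by rewrite /partial [LHS]deriveD.
Qed.

Lemma partial_cst (c : R) i : partial i (fun _ : 'rV[R]_n => c) = fun=> 0.
Proof. by apply/funext => x; rewrite /partial derive_cst. Qed.

Lemma C1_data_cst U (c : R) : C1_data U (fun=> c).
Proof. by move=> x _; split=> [|i]; [exact: cst_continuous|exact: derivable_cst]. Qed.

Lemma partialZ U (c : R) f i : C1_data U f ->
  {in U, partial i (fun x => c * f x) =1 (fun x => c * partial i f x)}.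
Proof.
move=> fU x xU; have cU : C1_data U (fun=> c) by exact: C1_data_cst.
by rewrite (partialM i cU fU xU) [X in X * _]/partial derive_cst mul0r add0r.
Qed.

Lemma partialB U f g i : C1_data U f -> C1_data U g ->
  {in U, partial i (fun x => f x - g x) =1 (fun x => partial i f x - partial i g x)}.
Proof.
move=> fU gU x; rewrite inE => Ux.
have [_ /(_ i) df] := fU x Ux; have [_ /(_ i) dg] := gU x Ux.
by rewrite /partial [LHS]deriveB.
Qed.

Lemma partial_sum U (I : finType) (F : I -> 'rV[R]_n -> R) i :
  (forall j, C1_data U (F j)) ->
  {in U, partial i (fun x => \sum_j F j x) =1 (fun x => \sum_j partial i (F j) x)}.
Proof.
move=> FU x xU; rewrite -[index_enum I]/(index_enum I).
elim: (index_enum I) => [|j s IH].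
  rewrite big_nil (_ : (fun _ => _) = fun=> 0) ?partial_cst//.
  by apply/funext => y; rewrite big_nil.
rewrite big_cons (_ : (fun _ => _) = fun x => F j x + \sum_(j <- s) F j x); last first.
  by apply/funext => y; rewrite big_cons.
rewrite (partialD _ (FU j) _ xU) ?IH//.
rewrite (_ : (fun _ => _) = \sum_(i <- s) F i); last first.
  by apply/funext => y; rewrite fct_sumE.
elim/big_ind: _ => [|f g fU gU|k _]; [exact: (@C1_data_cst U 0)|exact: C1_dataD|exact: FU].
Qed.

Lemma smoothM U f g : open U -> smooth_on U f -> smooth_on U g ->
  smooth_on U (fun x => f x * g x).
Proof. exact: smooth_onM. Qed.

Lemma smoothD U f g : open U -> smooth_on U f -> smooth_on U g ->
  smooth_on U (fun x => f x + g x).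
Proof. exact: smooth_onD. Qed.

Lemma smooth_sum U (I : finType) (F : I -> 'rV[R]_n -> R) : open U ->
  (forall i, smooth_on U (F i)) -> smooth_on U (fun x => \sum_i F i x).
Proof.
move=> oU FU; apply/smooth_onP => k; apply: Cupto_sum => // i.
by have /smooth_onP := FU i.
Qed.

Lemma smooth_prod U (I : finType) (F : I -> 'rV[R]_n -> R) : open U ->
  (forall i, smooth_on U (F i)) -> smooth_on U (fun x => \prod_i F i x).
Proof.
move=> oU FU; rewrite (_ : (fun _ => _) = \prod_i F i); last first.
  by apply/funext => x; rewrite fct_prodE.
elim/big_ind: _ => [|f g fU gU|k _]; [exact: (smooth_on_cst 1 oU)|exact: smooth_onM|exact: FU].
Qed.

Lemma smoothN U f : open U -> smooth_on U f -> smooth_on U (fun x => - f x).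
Proof.
move=> oU fU; rewrite (_ : (fun _ => _) = fun x => (-1) * f x).
  exact: (smoothM oU (smooth_on_cst (-1) oU) fU).
by apply/funext => x; rewrite mulN1r.
Qed.

Lemma smoothB U f g : open U -> smooth_on U f -> smooth_on U g ->
  smooth_on U (fun x => f x - g x).
Proof. by move=> oU fU gU; exact: (smoothD oU fU (smoothN oU gU)). Qed.

Lemma coord_is_derive x (i j : 'I_n) :
  is_derive x ('e_i) (fun y : 'rV[R]_n => y 0 j) ((i == j)%:R).
Proof.
have d : derivable (fun y : 'rV[R]_n => y) x 'e_i by exact: derivable_id.
split; first by move/derivable_mxP : d.
by have := derive_mx d; rewrite derive_id => /rowP/(_ j); rewrite !mxE eqxx/= eq_sym.
Qed.

Lemma partial_coord (i j : 'I_n) :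
  partial i (fun y : 'rV[R]_n => y 0 j) = fun=> (i == j)%:R.
Proof. by apply/funext => x; have [_] := coord_is_derive x i j. Qed.

Lemma smooth_coord U j : open U -> smooth_on U (fun y : 'rV[R]_n => y 0 j).
Proof.
move=> oU [|i s]; last by rewrite /= partial_coord; exact: smooth_on_cst.
move=> x Ux; split; first exact: coord_continuous.
by move=> i; have [] := coord_is_derive x i j.
Qed.

Lemma smoothV U f : open U -> (forall x, U x -> f x != 0) -> smooth_on U f ->
  smooth_on U (fun x => (f x)^-1).
Proof.
move=> oU fN0 fU; apply/smooth_onP.
have C1 : C1_data U (fun x => (f x)^-1).
  move=> x Ux; have [fc fd] := fU [::] x Ux; have f0 := fN0 x Ux; split=> [|i].
    exact: continuousV.
  exact: derivableV.
elim=> [|k IH]; first by move=> s; rewrite leqn0 size_eq0 => /eqP ->; exact: C1.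
apply: (CuptoS C1) => i.
have E : {in U, (fun x => (- partial i f x) * ((f x)^-1 * (f x)^-1)) =1
    partial i (fun x => (f x)^-1)}.
  move=> x /[!inE] Ux; have [_ /(_ i) fd] := fU [::] x Ux.
  rewrite /partial [RHS](deriveV (fN0 x Ux) fd) -exprVn expr2.
  by rewrite -[RHS]/(- _ * _) mulrC mulNr mulrN.
apply: (eq_Cupto oU E).
have /smooth_onP/(_ k) N := smoothN oU (smooth_on_partial i fU).
exact: (CuptoM oU N (CuptoM oU IH IH)).
Qed.

End SmoothToolkit.

Section Composition.
Context {R : realType} {n : nat}.
Variables (U V : set 'rV[R]_n) (psi : 'rV[R]_n -> 'rV[R]_n).
Hypotheses (oU : open U) (oV : open V) (UV : forall x, U x -> V (psi x)).
Hypothesis psi_smooth : forall j, smooth_on U (fun x => psi x 0 j).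

Lemma partial_comp g i : Cupto V 1 g -> {in U, partial i (g \o psi) =1
  (fun x => \sum_j partial i (fun y => psi y 0 j) x * partial j g (psi x))}.
Proof.
move=> gV x /[!inE] Ux.
have [|_ E] := chain_is_derive (v := 'e_i)
  (d := fun j => partial i (fun y => psi y 0 j) x) oV (UV Ux) gV; last exact: E.
by move=> j; have [_ /(_ i) d] := psi_smooth j [::] Ux; exact: derivableP.
Qed.

Lemma C1_data_comp g : Cupto V 1 g -> C1_data U (g \o psi).
Proof.
move=> gV x Ux; split=> [|i].
  apply: continuous_comp.
    by apply: continuous_row => j; have [] := psi_smooth j [::] Ux.
  by have [] := gV [::] isT _ (UV Ux).
have [|//] := chain_is_derive (v := 'e_i)
  (d := fun j => partial i (fun y => psi y 0 j) x) oV (UV Ux) gV.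
by move=> j; have [_ /(_ i) d] := psi_smooth j [::] Ux; exact: derivableP.
Qed.

Lemma smooth_comp g : smooth_on V g -> smooth_on U (g \o psi).
Proof.
move=> gV; apply/smooth_onP => k; elim: k g gV => [|k IH] g gV.
  case=> // _; apply: C1_data_comp; exact: smooth_Cupto.
apply: CuptoS; first by apply: C1_data_comp; exact: smooth_Cupto.
move=> i; apply: (eq_Cupto oU (f := fun x =>
  \sum_j partial i (fun y => psi y 0 j) x * (partial j g \o psi) x)).
  by move=> x xU; rewrite partial_comp//; exact: smooth_Cupto.
apply: Cupto_sum => // j; apply: (CuptoM oU (g := partial j g \o psi)).
  exact: smooth_Cupto (smooth_on_partial i (psi_smooth j)).
by apply: IH; exact: smooth_on_partial.
Qed.

End Composition.

(** * Bounds on all partial derivatives up to a given order *)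

Section Bounds.
Context {R : realType} {n : nat}.
Implicit Types (U V K : set 'rV[R]_n) (f g : 'rV[R]_n -> R) (r : nat).

(** A bound on the C^r norm of f on K, rather than the norm itself, as bounds
    make sense on any set and propagate by inequalities. *)
Definition dbound K r f (B : R) :=
  forall s, (size s <= r)%N -> forall x, K x -> `|partials s f x| <= B.

Lemma dbound_cons K r f B : (forall x, K x -> `|f x| <= B) ->
  (forall i, dbound K r (partial i f) B) -> dbound K r.+1 f B.
Proof. by move=> f0 fS [|i s] //= sr; exact: fS. Qed.

Lemma dbound_partial K r f B i : dbound K r.+1 f B -> dbound K r (partial i f) B.
Proof. by move=> fB s sr; exact: (fB (i :: s)). Qed.

Lemma dbound0 K r f B : dbound K r f B -> forall x, K x -> `|f x| <= B.
Proof. by move=> fB; exact: (fB [::]). Qed.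

Lemma dbound_leq K r r' f B : (r <= r')%N -> dbound K r' f B -> dbound K r f B.
Proof. by move=> rr fB s sr; apply: fB; exact: leq_trans rr. Qed.

Lemma dbound_le K r f (B B' : R) : B <= B' -> dbound K r f B -> dbound K r f B'.
Proof. by move=> BB fB s sr x Kx; exact: le_trans (fB s sr x Kx) BB. Qed.

Lemma dbound_ge0 r f B : dbound setT r f B -> 0 <= B.
Proof. by move=> fB; exact: le_trans (fB [::] isT 0 I). Qed.

Lemma dbound_finite K r (I : finType) (F : I -> 'rV[R]_n -> R) :
  (forall i, exists2 A, 0 <= A & dbound K r (F i) A) ->
  exists2 A, 0 <= A & forall i, dbound K r (F i) A.
Proof.
move=> ex; pose A i := s2val (cid2 (ex i)).
have [A0 FA] : (forall i, 0 <= A i) /\ forall i, dbound K r (F i) (A i).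
  by split=> i; rewrite /A; case: cid2.
move: A A0 FA => A A0 FA.
exists (\sum_i A i) => [|i]; first exact: sumr_ge0.
by apply: dbound_le (FA i); rewrite (bigD1 i isT)/= lerDl sumr_ge0.
Qed.

Lemma eq_partials U s f g : open U -> {in U, f =1 g} ->
  {in U, partials s f =1 partials s g}.
Proof.
by move=> oU; elim: s f g => [|i s IH] f g fg //=; apply: IH; exact: eq_partial.
Qed.

Lemma eq_dbound U K r f g B : open U -> K `<=` U -> {in U, f =1 g} ->
  dbound K r f B -> dbound K r g B.
Proof.
move=> oU KU fg fB s sr x Kx; rewrite -(eq_partials s oU fg) ?inE//; last exact: KU.
exact: fB.
Qed.

Lemma dboundD U K r f g A B : open U -> K `<=` U -> smooth_on U f ->
  smooth_on U g -> dbound K r f A -> dbound K r g B ->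
  dbound K r (fun x => f x + g x) (A + B).
Proof.
move=> oU KU; elim: r f g => [|r IH] f g fU gU fA gB.
  case=> // _ x Kx /=; rewrite (le_trans (ler_normD _ _))// lerD//.
    exact: (fA [::]).
  exact: (gB [::]).
apply: dbound_cons => [x Kx|i].
  by rewrite (le_trans (ler_normD _ _))// lerD//; [exact: (fA [::])|exact: (gB [::])].
apply: (eq_dbound oU KU (f := fun x => partial i f x + partial i g x)).
  by move=> x xU; rewrite (partialD _ _ _ xU)//; [exact: (fU [::])|exact: (gU [::])].
by apply: IH; try exact: smooth_on_partial; exact: dbound_partial.
Qed.

(** Leibniz' rule doubles the bound once for each derivative. *)
Lemma dboundM U K r f g A B : open U -> K `<=` U -> smooth_on U f ->
  smooth_on U g -> 0 <= A -> 0 <= B -> dbound K r f A -> dbound K r g B ->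
  dbound K r (fun x => f x * g x) (2 ^+ r * A * B).
Proof.
move=> oU KU fU gU A0 B0; move: fU gU.
have base (u v : R) : `|u| <= A -> `|v| <= B -> `|u * v| <= A * B.
  by move=> uA vB; rewrite normrM ler_pM.
elim: r f g => [|r IH] f g fU gU fA gB.
  by case=> // _ x Kx /=; rewrite expr0 mul1r base//; [exact: (fA [::])|exact: (gB [::])].
apply: dbound_cons => [x Kx|i].
  rewrite (le_trans (base _ _ (fA [::] _ _ Kx) (gB [::] _ _ Kx)))// -mulrA.
  by rewrite ler_peMl ?mulr_ge0// exprn_ege1// ler1n.
apply: (eq_dbound oU KU (f := fun x => partial i f x * g x + f x * partial i g x)).
  by move=> x xU; rewrite (partialM _ _ _ xU)//; [exact: (fU [::])|exact: (gU [::])].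
have -> : 2 ^+ r.+1 * A * B = 2 ^+ r * A * B + 2 ^+ r * A * B by rewrite exprS; ring.
have fUi := smooth_on_partial i fU; have gUi := smooth_on_partial i gU.
apply: (dboundD oU KU); try exact: smoothM.
  by apply: IH => //; [exact: dbound_partial|exact: (dbound_leq (leqnSn r))].
by apply: IH => //; [exact: (dbound_leq (leqnSn r))|exact: dbound_partial].
Qed.

Lemma dbound_cst K r (c : R) : dbound K r (fun=> c) `|c|.
Proof.
elim: r c => [|r IH] c; first by case.
apply: dbound_cons => // i; rewrite partial_cst.
by have := IH 0; rewrite normr0; apply: dbound_le.
Qed.

Lemma dboundZ U K r f (c A : R) : open U -> K `<=` U -> smooth_on U f ->
  dbound K r f A -> dbound K r (fun x => c * f x) (`|c| * A).
Proof.
move=> oU KU; elim: r f => [|r IH] f fU fA.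
  by case=> // _ x Kx /=; rewrite normrM ler_wpM2l//; exact: (fA [::]).
apply: dbound_cons => [x Kx|i].
  by rewrite normrM ler_wpM2l//; exact: (fA [::]).
apply: (eq_dbound oU KU (f := fun x => c * partial i f x)).
  move=> x xU; by rewrite (partialZ c i (fU [::]) xU).
by apply: IH; [exact: smooth_on_partial|exact: dbound_partial].
Qed.

Lemma dbound_sum U K r (I : finType) (F : I -> 'rV[R]_n -> R) A :
  open U -> K `<=` U -> (forall i, smooth_on U (F i)) ->
  (forall i, dbound K r (F i) A) ->
  dbound K r (fun x => \sum_i F i x) (#|I|%:R * A).
Proof.
move=> oU KU FU FA; rewrite cardE.
rewrite (_ : (fun _ => _) = fun x => \sum_(i <- enum I) F i x); last first.
  by apply/funext => x; rewrite big_enum.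
elim: (enum I) => [|i s IH] /=.
  rewrite mul0r (_ : (fun _ => _) = fun=> 0).
    by have := dbound_cst (K := K) (r := r) 0; rewrite normr0.
  by apply/funext => x; rewrite big_nil.
rewrite (_ : (fun _ => _) = fun x => F i x + \sum_(j <- s) F j x); last first.
  by apply/funext => y; rewrite big_cons.
rewrite -nat1r mulrDl mul1r; apply: (dboundD oU KU) => //.
rewrite (_ : (fun _ => _) = \sum_(i <- s) F i); last first.
  by apply/funext => y; rewrite fct_sumE.
elim/big_ind: _ => [|f g fU gU|k _]; [exact: (smooth_on_cst 0 oU)|exact: smooth_onD|exact: FU].
Qed.

(** Functions with bounded first derivatives are Lipschitz; the factor n comes
    from the supremum norm on vectors. *)
Lemma increment_bound g B : smooth_on setT g -> dbound setT 1 g B ->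
  forall x h, `|g (x + h) - g x| <= B * n%:R * `|h|.
Proof.
move=> gs gB x h.
have H y : `|y - x| < `|h| + 1 -> forall i, derivable g y ('e_i) /\
    `|partial i g y - 0| <= B.
  move=> _ i; rewrite subr0; split; last exact: (gB [:: i]).
  by have [] := gs [::] y I.
have := C1_increment (a := fun=> 0) H (h := h); rewrite ltrDl ltr01 => /(_ isT).
by rewrite big1 ?subr0// => i _; rewrite mul0r.
Qed.

(** The partial derivatives vary by at most B n |h| along the segment, by
    [increment_bound]; feed this into [C1_increment]. *)
Lemma increment2_bound g B : smooth_on setT g -> dbound setT 2 g B ->
  forall x h, `|g (x + h) - g x - \sum_i partial i g x * h 0 i|
    <= B * n%:R * n%:R * `|h| ^+ 2.
Proof.
move=> gs gB x h.
have [->|h0] := eqVneq h 0.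
  by rewrite addr0 subrr big1 ?subr0 ?normr0 ?expr0n ?mulr0// => i _; rewrite mxE mulr0.
have B0 := dbound_ge0 gB.
have L (e : R) : 0 < e -> `|g (x + h) - g x - \sum_i partial i g x * h 0 i|
    <= B * n%:R * (`|h| + e) * n%:R * `|h|.
  move=> e0; apply: (@C1_increment R n g x (`|h| + e)); last by rewrite ltrDl.
  move=> y yx i; split; first by have [] := gs [::] y I.
  have := increment_bound (smooth_on_partial i gs) (dbound_partial i gB) x (y - x).
  rewrite [x + _]addrC subrK => /le_trans; apply.
  by rewrite ler_wpM2l ?mulr_ge0// ltW.
apply/ler_addgt0Pr => e e0.
pose k := B * n%:R * n%:R * `|h|.
have k0 : 0 <= k by rewrite !mulr_ge0.
have := L (e / (k + 1)); rewrite divr_gt0 ?ltr_wpDl// => /(_ isT)/le_trans; apply.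
have -> : B * n%:R * (`|h| + e / (k + 1)) * n%:R * `|h| =
  B * n%:R * n%:R * `|h| ^+ 2 + k * (e / (k + 1)) by rewrite /k; ring.
rewrite lerD2l mulrCA ger_pMr// ler_pdivrMr ?ltr_wpDl//.
by rewrite mul1r lerDl.
Qed.

End Bounds.

Section CompBound.
Context {R : realType} {n : nat}.
Variables (U K V : set 'rV[R]_n) (psi : 'rV[R]_n -> 'rV[R]_n).
Hypotheses (oU : open U) (KU : K `<=` U).
Hypothesis psi_smooth : forall j, smooth_on U (fun x => psi x 0 j).

Lemma dbound_comp r (A : R) : 0 <= A ->
  (forall i j, dbound K r (partial i (fun x => psi x 0 j)) A) ->
  exists2 C, 0 <= C & forall g B, smooth_on setT g -> dbound setT r g B ->
    dbound K r (g \o psi) (C * B).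
Proof.
move=> A0; elim: r => [|r IH] psiA.
  exists 1 => // g B gs gB; case=> // _ x Kx /=; rewrite mul1r.
  exact: (gB [::]).
have [|C C0 HC] := IH.
  by move=> i j; exact: (dbound_leq (leqnSn r)).
have D0 : 0 <= n%:R * (2 ^+ r * A * C) by rewrite !mulr_ge0.
exists (1 + n%:R * (2 ^+ r * A * C)) => [|g B gs gB]; first by rewrite addr_ge0.
have B0 := dbound_ge0 gB.
apply: dbound_cons => [x Kx|i].
  rewrite (le_trans (dbound0 gB (x := psi x) I))//.
  by rewrite mulrDl mul1r lerDl mulr_ge0.
apply: (eq_dbound oU KU (f := (fun x =>
    \sum_j partial i (fun y => psi y 0 j) x * partial j g (psi x)))).
  move=> x xU; rewrite (@partial_comp _ _ U setT)//.
    exact: openT.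
apply: (@dbound_le _ _ _ _ _ (n%:R * (2 ^+ r * A * (C * B)))).
  by rewrite mulrDl mul1r -!mulrA lerDr.
have gpsi j := @smooth_comp _ _ U setT _ oU openT (fun _ _ => I) psi_smooth _
  (smooth_on_partial j gs).
rewrite -[n in n%:R](card_ord n); apply: (dbound_sum oU KU) => j.
  exact: (smoothM oU (smooth_on_partial i (psi_smooth j)) (gpsi j)).
apply: (dboundM oU KU (smooth_on_partial i (psi_smooth j)) (gpsi j) A0 (mulr_ge0 C0 B0)).
  exact: (dbound_leq (leqnSn r)).
exact: (HC _ _ (smooth_on_partial j gs) (dbound_partial j gB)).
Qed.

End CompBound.

(** * Pulling functions back by one Euler step *)

Section Euler.
Context {R : realType} {n : nat}.
Variable a : 'I_n -> 'rV[R]_n -> R.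
Implicit Types (g : 'rV[R]_n -> R) (r : nat) (t : R).

Definition vfield x : 'rV[R]_n := \row_j a j x.
Definition euler t x : 'rV[R]_n := x + t *: vfield x.
Definition along g x : R := \sum_j a j x * partial j g x.

Hypothesis a_smooth : forall j, smooth_on setT (a j).
Hypothesis a_bounded : forall r, exists2 A, 0 <= A &
  forall j, dbound setT r (a j) A.

Lemma euler_coord t j : (fun x => euler t x 0 j) = (fun x => x 0 j + t * a j x).
Proof. by apply/funext => x; rewrite !mxE. Qed.

Lemma euler_smooth t j : smooth_on setT (fun x => euler t x 0 j).
Proof.
rewrite euler_coord; apply: smoothD openT _ _; first exact: smooth_coord openT.
by apply: smoothM openT _ (a_smooth j); exact: smooth_on_cst openT.
Qed.

Lemma smooth_euler t g : smooth_on setT g -> smooth_on setT (g \o euler t).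
Proof. exact: (smooth_comp openT openT (fun _ _ => I) (euler_smooth t)). Qed.

Lemma smooth_along g : smooth_on setT g -> smooth_on setT (along g).
Proof.
move=> gs; apply: (smooth_sum openT) => j.
exact: (smoothM openT (a_smooth j) (smooth_on_partial j gs)).
Qed.

(** The t-linear term in the chain rule for g o E, coming from the derivatives
    of the vector field. *)
Definition twist i t g x := \sum_j partial i (a j) x * partial j g (euler t x).

Lemma twist_smooth i t g : smooth_on setT g -> smooth_on setT (twist i t g).
Proof.
move=> gs; apply: (smooth_sum openT) => j.
exact: (smoothM openT (smooth_on_partial i (a_smooth j))
  (smooth_euler t (smooth_on_partial j gs))).
Qed.

Lemma partial_euler i t g : smooth_on setT g ->
  partial i (g \o euler t) =
  (fun x => (partial i g \o euler t) x + t * twist i t g x).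
Proof.
move=> gs; apply/funext => x.
rewrite (partial_comp openT (fun _ _ => I) (euler_smooth t)) ?inE//.
transitivity (\sum_j ((i == j)%:R + t * partial i (a j) x) * partial j g (euler t x)).
  apply: eq_bigr => j _; congr (_ * _); rewrite euler_coord.
  have aj := smoothM openT (smooth_on_cst t openT) (a_smooth j).
  rewrite (partialD i (smooth_coord j openT [::]) (aj [::]) (in_setT x)).
  by rewrite partial_coord (partialZ t i (a_smooth j [::]) (in_setT x)).
under eq_bigr do rewrite mulrDl -mulrA; rewrite big_split/= -mulr_sumr; congr (_ + _).
rewrite (bigD1 i)//= eqxx mul1r big1 ?addr0// => j; rewrite eq_sym => /negPf ->.
by rewrite mul0r.
Qed.

Lemma dbound_twist r : exists2 D, 0 <= D & forall i t g B,
  0 <= B -> smooth_on setT g ->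
  (forall j, dbound setT r (partial j g \o euler t) B) ->
  dbound setT r (twist i t g) (D * B).
Proof.
have [A A0 HA] := a_bounded r.+1.
exists (n%:R * (2 ^+ r * A)); first by rewrite !mulr_ge0.
move=> i t g B B0 gs gB; rewrite -[n in n%:R](card_ord n) -mulrA.
apply: (dbound_sum openT (@subset_refl _ _)) => j.
  exact: (smoothM openT (smooth_on_partial i (a_smooth j))
    (smooth_euler t (smooth_on_partial j gs))).
exact: (dboundM openT (@subset_refl _ _) (smooth_on_partial i (a_smooth j))
  (smooth_euler t (smooth_on_partial j gs)) A0 B0 (dbound_partial i (HA j)) (gB j)).
Qed.

(** The differential of the Euler step is the identity plus O(t), so the factor
    is 1 + O(t) and not a mere constant: this is what survives T / t
    compositions. *)
Lemma euler_bound r : exists2 C, 0 <= C & forall t g B, `|t| <= 1 ->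
  smooth_on setT g -> dbound setT r g B ->
  dbound setT r (g \o euler t) ((1 + C * `|t|) * B).
Proof.
elim: r => [|r [C C0 HC]].
  exists 0 => // t g B t1 gs gB; case=> // _ x _ /=.
  by rewrite mul0r addr0 mul1r; exact: (gB [::]).
have [D D0 HD] := dbound_twist r.
have DC0 : 0 <= D * (1 + C) by rewrite mulr_ge0// addr_ge0.
exists (C + D * (1 + C)) => [|t g B t1 gs gB]; first by rewrite addr_ge0.
have B0 := dbound_ge0 gB.
apply: dbound_cons => [x _|i].
  rewrite (le_trans (dbound0 gB (x := euler t x) I))//.
  by rewrite mulrDl mul1r lerDl !mulr_ge0// addr_ge0.
rewrite partial_euler//.
have gj j : dbound setT r (partial j g \o euler t) ((1 + C * `|t|) * B).
  exact: (HC _ _ _ t1 (smooth_on_partial j gs) (dbound_partial j gB)).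
have gj' j : dbound setT r (partial j g \o euler t) ((1 + C) * B).
  apply: dbound_le (gj j); rewrite ler_wpM2r// lerD2l.
  by rewrite ler_piMr.
have K : dbound setT r (fun x => t * twist i t g x) (`|t| * (D * ((1 + C) * B))).
  apply: (dboundZ t openT (@subset_refl _ _)); first exact: twist_smooth.
  by apply: HD => //; rewrite mulr_ge0// addr_ge0.
have S1 : smooth_on setT (partial i g \o euler t).
  by apply: smooth_euler; exact: smooth_on_partial.
have S2 := smoothM openT (smooth_on_cst t openT) (twist_smooth i t gs).
apply: dbound_le (dboundD openT (@subset_refl _ _) S1 S2 (gj i) K).
by rewrite le_eqVlt; apply/orP; left; apply/eqP; ring.
Qed.

Lemma vfield_bounded : exists2 A, 0 <= A & forall x, `|vfield x| <= A.
Proof.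
have [A A0 HA] := a_bounded 0; exists A => // x.
by apply: rV_norm_le => // i; rewrite mxE; exact: (HA i [::]).
Qed.

(** One more derivative on g buys one factor t. *)
Lemma euler_diff_bound r : exists2 C, 0 <= C & forall t g B, `|t| <= 1 ->
  smooth_on setT g -> dbound setT r.+1 g B ->
  dbound setT r (fun x => (g \o euler t) x - g x) (C * `|t| * B).
Proof.
elim: r => [|r [C C0 HC]].
  have [A A0 HA] := vfield_bounded.
  exists (n%:R * A) => [|t g B t1 gs gB]; first by rewrite mulr_ge0.
  case=> // _ x _ /=; have B0 := dbound_ge0 gB.
  rewrite (le_trans (increment_bound gs gB _ _))// normrZ.
  rewrite -[B * n%:R * _]mulrA mulrC [n%:R * (_ * _)]mulrA [n%:R * A * _]mulrAC.
  by rewrite ler_wpM2r// ler_wpM2l// mulr_ge0.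
have [D D0 HD] := dbound_twist r.
have [C' C'0 HC'] := euler_bound r.
have [A A0 HA] := vfield_bounded.
have K0 : 0 <= C + D * (1 + C') by rewrite addr_ge0// mulr_ge0// addr_ge0.
exists (n%:R * A + (C + D * (1 + C'))) => [|t g B t1 gs gB].
  by rewrite addr_ge0// mulr_ge0.
have B0 := dbound_ge0 gB.
apply: dbound_cons => [x _|i].
  rewrite (le_trans (increment_bound gs (dbound_leq (isT : (1 <= r.+2)%N) gB) _ _))//.
  rewrite normrZ (@le_trans _ _ (n%:R * A * `|t| * B))//.
    rewrite -[B * n%:R * _]mulrA mulrC [n%:R * (_ * _)]mulrA [n%:R * A * _]mulrAC.
    by rewrite ler_wpM2r// ler_wpM2l// mulr_ge0.
  by rewrite ler_wpM2r// ler_wpM2r// lerDl.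
have gis := smooth_on_partial i gs.
have S1 := smooth_euler t gis.
have S2 := smoothM openT (smooth_on_cst t openT) (twist_smooth i t gs).
rewrite (_ : partial i _ = fun x =>
  ((partial i g \o euler t) x - partial i g x) + t * twist i t g x); last first.
  apply/funext => x; have E := partial_euler i t gs.
  rewrite (partialB i (smooth_euler t gs [::]) (gs [::]) (in_setT x)) E.
  by rewrite addrAC.
have gj j : dbound setT r (partial j g \o euler t) ((1 + C') * B).
  have gB' := dbound_leq (leqnSn _) gB.
  apply: (@dbound_le _ _ _ _ _ ((1 + C' * `|t|) * B)); last first.
    exact: (HC' _ _ _ t1 (smooth_on_partial j gs) (dbound_partial j gB')).
  by rewrite ler_wpM2r// lerD2l ler_piMr.
have K1 := HC t (partial i g) B t1 gis (dbound_partial i gB).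
have K2 : dbound setT r (fun x => t * twist i t g x) (`|t| * (D * ((1 + C') * B))).
  apply: (dboundZ t openT (@subset_refl _ _)); first exact: twist_smooth.
  by apply: HD => //; rewrite mulr_ge0// addr_ge0.
apply: dbound_le (dboundD openT (@subset_refl _ _) (smoothB openT S1 gis) S2 K1 K2).
have -> : C * `|t| * B + `|t| * (D * ((1 + C') * B)) = (C + D * (1 + C')) * `|t| * B by ring.
by rewrite ler_wpM2r// ler_wpM2r// lerDr mulr_ge0.
Qed.

End Euler.

Section Schwarz.
Context {R : realType} {n : nat}.
Implicit Types (g : 'rV[R]_n -> R) (i j k : 'I_n).

Let ecst j k : 'rV[R]_n -> R := fun=> (k == j)%:R.

Let ecst_smooth j k : smooth_on setT (ecst j k).
Proof. exact: smooth_on_cst openT. Qed.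

Let ecst_bounded j r : exists2 A, 0 <= A & forall k, dbound setT r (ecst j k) A.
Proof.
exists 1 => // k; apply: (dbound_le _ (dbound_cst _)).
by case: eqP; rewrite ?normr1 ?normr0.
Qed.

Let euler_ecst j t x : euler (ecst j) t x = x + t *: 'e_j.
Proof. by apply/rowP => k; rewrite !mxE eqxx. Qed.

(** The second difference of g in the directions i and j is the i-difference of
    the j-difference, whose derivatives are O(t) by [euler_diff_bound] for the
    constant vector field e_j. *)
Lemma second_difference g B : smooth_on setT g -> dbound setT 3 g B ->
  exists2 K, 0 <= K & forall i j x (t : R), `|t| <= 1 ->
    `|(g (x + t *: 'e_i + t *: 'e_j) - g (x + t *: 'e_i) - (g (x + t *: 'e_j) - g x))
      - t ^+ 2 * partial j (partial i g) x| <= K * `|t| ^+ 3.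
Proof.
move=> gs gB; have B0 := dbound_ge0 gB.
have exC j : exists2 C, 0 <= C & forall t, `|t| <= 1 ->
  dbound setT 2 (fun x => (g \o euler (ecst j) t) x - g x) (C * `|t| * B).
  have [C C0 HC] := euler_diff_bound (ecst_smooth j) (ecst_bounded j) 2.
  by exists C => // t t1; exact: HC.
pose C j := s2val (cid2 (exC j)).
have C0 j : 0 <= C j by rewrite /C; case: cid2.
have HC j : forall t, `|t| <= 1 ->
  dbound setT 2 (fun x => (g \o euler (ecst j) t) x - g x) (C j * `|t| * B).
  by rewrite /C; case: cid2.
pose CC := \sum_j C j.
have CC0 : 0 <= CC by rewrite sumr_ge0.
exists (CC * B * n%:R * n%:R + B * n%:R * n%:R) => [|i j x t t1].
  by rewrite addr_ge0// !mulr_ge0.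
pose F := fun x => (g \o euler (ecst j) t) x - g x.
have gts := smooth_euler (ecst_smooth j) t gs.
have Fs : smooth_on setT F by exact: smoothB openT gts gs.
have Fi y : partial i F y = partial i g (y + t *: 'e_j) - partial i g y.
  rewrite (partialB i (gts [::]) (gs [::]) (in_setT y)).
  rewrite (partial_euler (ecst_smooth j) i t gs); congr (_ - _).
  rewrite /twist big1 ?mulr0 ?addr0 => [|k _]; first by rewrite /= euler_ecst.
  by rewrite /ecst [X in X * _]/partial derive_cst mul0r.
have normte k : `|t *: ('e_k : 'rV[R]_n)| <= `|t|.
  by rewrite normrZ ler_piMr// norm_e_le1.
have HF := increment2_bound Fs (HC j t t1) x (t *: 'e_i).
have gis := smooth_on_partial i gs.
have Hg := increment2_bound gis (dbound_partial i gB) x (t *: 'e_j).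
have sumE (G : 'I_n -> R) k : \sum_l G l * (t *: ('e_k : 'rV[R]_n)) 0 l = t * G k.
  rewrite (bigD1 k)//= !mxE !eqxx mulr1 big1 ?addr0 1?mulrC// => l lk.
  by rewrite !mxE (negPf lk) andbF mulr0 mulr0.
rewrite sumE Fi /F /= !euler_ecst in HF; rewrite sumE in Hg.
set a := partial i g _ - _ in HF Hg.
set D := g (_ + _) - g (_ + _) - _; rewrite -/D in HF.
have -> : D - t ^+ 2 * partial j (partial i g) x =
  (D - t * a) + t * (a - t * partial j (partial i g) x) by ring.
rewrite (le_trans (ler_normD _ _))// mulrDl lerD//.
  apply: (le_trans HF).
  apply: (@le_trans _ _ (C j * `|t| * B * n%:R * n%:R * `|t| ^+ 2)).
    by rewrite ler_wpM2l ?mulr_ge0// ler_pXn2r// nnegrE.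
  have -> : C j * `|t| * B * n%:R * n%:R * `|t| ^+ 2 = C j * (B * n%:R * n%:R * `|t| ^+ 3) by ring.
  rewrite -!mulrA ler_wpM2r ?mulr_ge0//.
  by rewrite /CC (bigD1 j)//= lerDl sumr_ge0.
rewrite normrM (@le_trans _ _ (`|t| * (B * n%:R * n%:R * `|t| ^+ 2)))//.
  rewrite ler_wpM2l//; apply: (le_trans Hg).
  by rewrite ler_wpM2l ?mulr_ge0// ler_pXn2r// nnegrE.
by rewrite le_eqVlt; apply/orP; left; apply/eqP; ring.
Qed.

(** Schwarz' theorem: the second difference is symmetric in i and j, and it
    determines the mixed derivative when t tends to 0. *)
Lemma partial_swap g B i j x : smooth_on setT g -> dbound setT 3 g B ->
  partial i (partial j g) x = partial j (partial i g) x.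
Proof.
move=> gs gB; have [K K0 HK] := second_difference gs gB.
apply/eqP; rewrite -subr_eq0 -normr_le0.
apply/ler_addgt0Pr => e e0; rewrite add0r.
(* this t makes the error 2 K t^3 of two second differences at most e t^2 *)
pose t := Num.min 1 (e / (2 * K + 1)).
have k0 : 0 < 2 * K + 1 by rewrite ltr_wpDl// mulr_ge0.
have t0 : 0 < t by rewrite lt_min ltr01 divr_gt0.
have t1 : `|t| <= 1 by rewrite gtr0_norm// ge_min lexx.
have H1 := HK i j x t t1; have H2 := HK j i x t t1.
set a := partial i (partial j g) x in H2 *; set b := partial j (partial i g) x in H1 *.
set D := g (_ + _ *: 'e_j + _) - g _ - _ in H2.
have D12 : g (x + t *: 'e_i + t *: 'e_j) - g (x + t *: 'e_i) - (g (x + t *: 'e_j) - g x) = D.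
  by rewrite /D [x + t *: 'e_j + _]addrAC; ring.
rewrite D12 in H1.
rewrite -(ler_pM2l (exprn_gt0 2 t0)).
have -> : t ^+ 2 * `|a - b| = `|(D - t ^+ 2 * b) - (D - t ^+ 2 * a)|.
  rewrite -[in LHS](@gtr0_norm _ (t ^+ 2)) ?exprn_gt0// -normrM; congr `|_|; ring.
rewrite (le_trans (ler_normB _ _))// (le_trans (lerD H1 H2))//.
rewrite gtr0_norm// -mulrDl -mulr2n -mulr_natl exprS mulrA mulrC.
rewrite ler_wpM2l ?exprn_ge0 ?(ltW t0)//.
rewrite (@le_trans _ _ ((2 * K + 1) * (e / (2 * K + 1))))//.
  by rewrite ler_pM ?(ltW t0) ?mulr_ge0 ?lerDl// ge_min lexx orbT.
by rewrite mulrC divfK ?gt_eqF.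
Qed.

End Schwarz.

Section EulerRemainder.
Context {R : realType} {n : nat}.
Variable a : 'I_n -> 'rV[R]_n -> R.
Hypothesis a_smooth : forall j, smooth_on setT (a j).
Hypothesis a_bounded : forall r, exists2 A, 0 <= A &
  forall j, dbound setT r (a j) A.

(** By induction on r.  Differentiating the remainder of g gives the remainder
    of a partial derivative of g, because partial derivatives commute, plus t
    times a first order difference, which is O(t) by [euler_diff_bound].  The
    third derivative is spent on the commutation. *)
Lemma euler_remainder_bound r : exists2 C, 0 <= C & forall t g B, `|t| <= 1 ->
  smooth_on setT g -> dbound setT r.+3 g B ->
  dbound setT r (fun x => (g \o euler a t) x - g x - t * along a g x)
    (C * `|t| ^+ 2 * B).
Proof.
have base A : 0 <= A -> (forall x, `|vfield a x| <= A) ->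
  forall t g B, `|t| <= 1 -> smooth_on setT g -> dbound setT 3 g B -> forall x,
  `|(g \o euler a t) x - g x - t * along a g x| <= n%:R * n%:R * A ^+ 2 * `|t| ^+ 2 * B.
  move=> A0 HA t g B t1 gs gB x; have B0 := dbound_ge0 gB.
  have -> : t * along a g x = \sum_i partial i g x * (t *: vfield a x) 0 i.
    rewrite /along mulr_sumr; apply: eq_bigr => i _; rewrite !mxE.
    by rewrite mulrA mulrC.
  have H := increment2_bound gs (dbound_leq (isT : (2 <= 3)%N) gB) x (t *: vfield a x).
  apply: (le_trans H); rewrite normrZ exprMn.
  apply: (@le_trans _ _ (B * n%:R * n%:R * (`|t| ^+ 2 * A ^+ 2))).
    by rewrite ler_wpM2l ?mulr_ge0// ler_wpM2l ?exprn_ge0// ler_pXn2r// nnegrE.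
  by rewrite le_eqVlt; apply/orP; left; apply/eqP; ring.
elim: r => [|r [C C0 HC]].
  have [A A0 HA] := vfield_bounded a_bounded.
  exists (n%:R * n%:R * A ^+ 2) => [|t g B t1 gs gB]; first by rewrite !mulr_ge0.
  by case=> // _ x _ /=; exact: base.
have [A A0 HA] := a_bounded r.+1.
have [C' C'0 HC'] := euler_diff_bound a_smooth a_bounded r.
have [V V0 HV] := vfield_bounded a_bounded.
pose D := n%:R * (2 ^+ r * A * C').
have D0 : 0 <= D by rewrite !mulr_ge0.
have E0 : 0 <= n%:R * n%:R * V ^+ 2 by rewrite !mulr_ge0.
exists (n%:R * n%:R * V ^+ 2 + (C + D)) => [|t g B t1 gs gB].
  by rewrite addr_ge0// addr_ge0.
have B0 := dbound_ge0 gB; have CD0 : 0 <= C + D by rewrite addr_ge0.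
apply: dbound_cons => [x _|i].
  have Hb := base V V0 HV t g B t1 gs (dbound_leq (isT : (3 <= r.+4)%N) gB) x.
  apply: (le_trans Hb).
  by rewrite ler_wpM2r// ler_wpM2r// lerDl.
have gis := smooth_on_partial i gs.
have gts := smooth_euler a_smooth t gs.
have alongs := smooth_along a_smooth gs.
have dgs j := smooth_on_partial j gs.
pose T x := \sum_j partial i (a j) x * ((partial j g \o euler a t) x - partial j g x).
have dgE j := smoothB openT (smooth_euler a_smooth t (dgs j)) (dgs j).
have Tjs j := smoothM openT (smooth_on_partial i (a_smooth j)) (dgE j).
have Ts : smooth_on setT T by exact: (smooth_sum openT Tjs).
rewrite (_ : partial i _ = fun x => ((partial i g \o euler a t) x - partial i g x
   - t * along a (partial i g) x) + t * T x); last first.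
  apply/funext => x; have tas := smoothM openT (smooth_on_cst t openT) alongs.
  rewrite (partialB i (smoothB openT gts gs [::]) (tas [::]) (in_setT x)).
  rewrite (partialB i (gts [::]) (gs [::]) (in_setT x)).
  rewrite (partialZ t i (alongs [::]) (in_setT x)) (partial_euler a_smooth i t gs).
  have ads j := smoothM openT (a_smooth j) (dgs j).
  rewrite (partial_sum i (fun j => ads j [::]) (in_setT x)).
  have -> : \sum_j partial i (fun x => a j x * partial j g x) x =
    \sum_j partial i (a j) x * partial j g x + along a (partial i g) x.
    rewrite /along -big_split/=; apply: eq_bigr => j _.
    rewrite (partialM i (a_smooth j [::]) (dgs j [::]) (in_setT x)).
    by rewrite (partial_swap i j x gs (dbound_leq (isT : (3 <= r.+4)%N) gB)).
  have -> : T x = twist a i t g x - \sum_j partial i (a j) x * partial j g x.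
    by rewrite /twist -sumrB; apply: eq_bigr => j _; rewrite mulrBr.
  by ring.
have K1 := HC t (partial i g) B t1 gis (dbound_partial i gB).
have K2 : dbound setT r (fun x => t * T x) (`|t| * (n%:R * (2 ^+ r * A * (C' * `|t| * B)))).
  apply: (dboundZ t openT (@subset_refl _ _) Ts).
  rewrite -[n in n%:R](card_ord n).
  apply: (dbound_sum openT (@subset_refl _ _) Tjs) => j.
  apply: (dboundM openT (@subset_refl _ _) (smooth_on_partial i (a_smooth j)) (dgE j) A0).
  - by rewrite !mulr_ge0.
  - exact: dbound_partial (HA j).
  - apply: (HC' _ _ _ t1 (dgs j)).
    exact: (dbound_leq (leqW (leqnSn r.+1)) (dbound_partial j gB)).
have s1 := smoothB openT (smooth_euler a_smooth t gis) gis.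
have s2 := smoothM openT (smooth_on_cst t openT) (smooth_along a_smooth gis).
have s3 := smoothM openT (smooth_on_cst t openT) Ts.
apply: dbound_le (dboundD openT (@subset_refl _ _) (smoothB openT s1 s2) s3 K1 K2).
have -> : C * `|t| ^+ 2 * B + `|t| * (n%:R * (2 ^+ r * A * (C' * `|t| * B))) =
  (C + D) * `|t| ^+ 2 * B by rewrite /D; ring.
by rewrite ler_wpM2r// ler_wpM2r ?exprn_ge0// lerDr.
Qed.

End EulerRemainder.

(** * The Euler scheme and the integral curve that it follows *)

Section EulerScheme.
Context {R : realType} {n : nat}.
Variable a : 'I_n -> 'rV[R]_n -> R.
Hypothesis a_smooth : forall j, smooth_on setT (a j).
Hypothesis a_bounded : forall r, exists2 A, 0 <= A &
  forall j, dbound setT r (a j) A.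
Implicit Types (g : 'rV[R]_n -> R) (t : R).

Definition pullback t j g : 'rV[R]_n -> R := g \o iter j (euler a t).

Lemma pullbackS t j g : pullback t j.+1 g = pullback t j g \o euler a t.
Proof. by apply/funext => x; rewrite /pullback /= -iterS iterSr. Qed.

Lemma smooth_pullback t j g : smooth_on setT g -> smooth_on setT (pullback t j g).
Proof.
move=> gs; elim: j => [//|j IH]; rewrite pullbackS.
exact: (smooth_euler a_smooth t IH).
Qed.

(** Discrete Gronwall: (1 + C t)^j is at most exp(C j t), which is bounded as
    long as the total time j t is. *)
Lemma pullback_bound r : exists2 C, 0 <= C & forall t g B j, `|t| <= 1 ->
  smooth_on setT g -> dbound setT r g B ->
  dbound setT r (pullback t j g) (expR (C * (j%:R * `|t|)) * B).
Proof.
have [C C0 HC] := euler_bound a_smooth a_bounded r.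
exists C => // t g B j t1 gs gB; elim: j => [|j IH].
  by rewrite mul0r mulr0 expR0 mul1r.
have B0 := dbound_ge0 gB.
rewrite pullbackS; apply: dbound_le (HC t _ _ t1 (smooth_pullback t j gs) IH).
rewrite mulrA ler_wpM2r//.
have -> : C * (j.+1%:R * `|t|) = C * `|t| + C * (j%:R * `|t|) by rewrite -natr1; ring.
rewrite expRD ler_wpM2r ?expR_ge0//.
exact: expR_ge1Dx.
Qed.

(** A functional that kills derivatives along the vector field sends this sum to
    the difference between its values at the last and at the first iterate. *)
Definition scheme_defect t m g x := \sum_(j < m)
  (pullback t j.+1 g x - pullback t j g x - t * along a (pullback t j g) x).

(** m steps of length T / m, each with an error O((T / m)^2). *)
Lemma scheme_defect_bound r g B (T : R) : smooth_on setT g ->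
  dbound setT r.+3 g B ->
  exists2 C, 0 <= C & forall m, `|T| <= m.+1%:R ->
    dbound setT r (scheme_defect (T / m.+1%:R) m.+1 g) (C / m.+1%:R).
Proof.
move=> gs gB; have B0 := dbound_ge0 gB.
have [C C0 HC] := euler_remainder_bound a_smooth a_bounded r.
have [D D0 HD] := pullback_bound r.+3.
exists (C * `|T| ^+ 2 * (expR (D * `|T|) * B)) => [|m Tm].
  by rewrite !mulr_ge0// expR_ge0.
set t := T / _; have m0 : 0 < m.+1%:R :> R by [].
have tE : m.+1%:R * `|t| = `|T|.
  by rewrite /t normrM normfV normr_nat mulrCA mulfV ?mulr1 ?gt_eqF.
have t1 : `|t| <= 1 by rewrite -(ler_pM2l m0) tE mulr1.
have Hj (j : 'I_m.+1) : dbound setT r (fun x => pullback t j.+1 g x - pullback t j g x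
     - t * along a (pullback t j g) x) (C * `|t| ^+ 2 * (expR (D * `|T|) * B)).
  have gjs := smooth_pullback t j gs.
  rewrite pullbackS; apply: (HC t _ _ t1 gjs).
  apply: dbound_le (HD t g B j t1 gs gB).
  rewrite ler_wpM2r// ler_expR ler_wpM2l// -tE ler_wpM2r// ler_nat.
  exact: ltnW.
have sj (j : 'I_m.+1) : smooth_on setT (fun x => pullback t j.+1 g x - pullback t j g x
     - t * along a (pullback t j g) x).
  have gjs := smooth_pullback t j gs.
  have s1 := smoothB openT (smooth_pullback t j.+1 gs) gjs.
  exact: (smoothB openT s1 (smoothM openT (smooth_on_cst t openT) (smooth_along a_smooth gjs))).
have := dbound_sum openT (@subset_refl _ _) sj Hj.
rewrite card_ord; apply: dbound_le.
have -> : `|t| = `|T| / m.+1%:R by rewrite -tE mulrC mulKf ?gt_eqF.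
rewrite le_eqVlt; apply/orP; left; apply/eqP.
have : m.+1%:R != 0 :> R by rewrite gt_eqF.
by move: (m.+1%:R : R) => M M0; field.
Qed.

End EulerScheme.

Section Tracking.
Context {R : realType} {n : nat}.
Variable a : 'I_n -> 'rV[R]_n -> R.
Hypothesis a_smooth : forall j, smooth_on setT (a j).
Hypothesis a_bounded : forall r, exists2 A, 0 <= A &
  forall j, dbound setT r (a j) A.

Lemma mvt_ball (phi d : R -> R) (t0 e : R) :
  (forall t, `|t - t0| < e -> is_derive t 1 phi (d t)) ->
  forall s t, `|s - t0| < e -> `|t - t0| < e ->
  exists xi, [/\ `|xi - t0| < e, `|xi - t| <= `|s - t| &
    phi s - phi t = d xi * (s - t)].
Proof.
move=> H.
suff G s t : s <= t -> `|s - t0| < e -> `|t - t0| < e ->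
  exists xi, [/\ `|xi - t0| < e, s <= xi, xi <= t & phi t - phi s = d xi * (t - s)].
  move=> s t se te; case: (leP s t) => [st|/ltW ts].
    have [xi [xe sx xt E]] := G _ _ st se te; exists xi; split=> //.
      by rewrite !ler0_norm ?subr_le0// lerN2 lerD2r.
    by rewrite -opprB E -mulrN opprB.
  have [xi [xe sx xt E]] := G _ _ ts te se; exists xi; split=> //.
  by rewrite !ger0_norm ?subr_ge0// lerD2r.
move=> st se te.
have I0 u : u \in `[s, t] -> `|u - t0| < e.
  rewrite in_itv/= => /andP[su ut].
  move: se te; rewrite !ltr_norml => /andP[s1 s2] /andP[t1 t2]; apply/andP; split.
    by rewrite (lt_le_trans s1)// lerD2r.
  by rewrite (le_lt_trans _ t2)// lerD2r.
have [||xi xi_in E] := @MVT_segment R phi d s t st _ _.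
- by move=> u uI; apply: H; apply: I0; move: uI; rewrite !in_itv/= => /andP[/ltW-> /ltW->].
- by apply: derivable_within_continuous => u uI; have [] := H u (I0 u uI).
exists xi; split=> //; first exact: I0.
  by move: xi_in; rewrite in_itv/= => /andP[].
by move: xi_in; rewrite in_itv/= => /andP[].
Qed.

Variables (y : R -> 'rV[R]_n) (t0 e : R).
Hypothesis y_curve : forall t, `|t - t0| < e ->
  forall i, is_derive t 1 (fun s => y s 0 i) (a i (y t)).

Lemma vfield_lipschitz : exists2 L, 0 <= L &
  forall x z, `|vfield a x - vfield a z| <= L * `|x - z|.
Proof.
have [A A0 HA] := a_bounded 1; exists (A * n%:R) => [|x z]; first by rewrite mulr_ge0.
apply: rV_norm_le => [|i]; first by rewrite !mulr_ge0.
have := increment_bound (a_smooth i) (HA i) z (x - z).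
by rewrite [z + _]addrC subrK !mxE.
Qed.

(** The local error of Euler's method is quadratic, since the curve has a
    Lipschitz velocity. *)
Lemma curve_consistent : exists2 C, 0 <= C & forall t u,
  `|t - t0| < e -> `|t + u - t0| < e ->
  `|euler a u (y t) - y (t + u)| <= C * `|u| ^+ 2.
Proof.
have [A A0 HA] := a_bounded 0; have [L L0 HL] := vfield_lipschitz.
exists (L * A) => [|t u te ue]; first by rewrite mulr_ge0.
have ylip s t' : `|s - t0| < e -> `|t' - t0| < e -> `|y s - y t'| <= A * `|s - t'|.
  move=> se te'; apply: rV_norm_le => [|i]; first by rewrite mulr_ge0.
  have [xi [_ _ E]] := mvt_ball (fun t te => y_curve te i) se te'.
  by rewrite !mxE E normrM ler_wpM2r//; exact: (HA i [::]).
apply: rV_norm_le => [|i]; first by rewrite !mulr_ge0// exprn_ge0.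
have [xi [xie xiu E]] := mvt_ball (fun t te => y_curve te i) ue te.
rewrite [t + u]addrC addrK in xiu E; rewrite !mxE [t + u]addrC.
have -> : y t 0 i + u * a i (y t) - y (u + t) 0 i = u * (a i (y t) - a i (y xi)).
  by rewrite mulrBr [u * a i (y xi)]mulrC -E; ring.
have -> : L * A * `|u| ^+ 2 = `|u| * (L * (A * `|u|)) by ring.
rewrite normrM ler_wpM2l//.
have := ler_norm_coord (vfield a (y t) - vfield a (y xi)) i; rewrite !mxE => /le_trans.
apply; rewrite (le_trans (HL _ _))// ler_wpM2l//.
rewrite (le_trans (ylip _ _ te xie))// ler_wpM2l//.
by rewrite distrC.
Qed.

(** Stability of Euler's method, read backwards: one step shrinks distances at most
    by the factor 1 - L |u|, so a point whose j-th iterate is close to y(s) was itself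
    close to y(s - j u).  The constant C has to dominate both the Lipschitz
    constant of the field, with the factor 2 of 1 / (1 - v) <= 1 + 2 v, and the
    local error. *)
Lemma euler_tracking : exists C, 0 <= C /\ forall u, C * `|u| <= 1 -> forall j x s,
  (forall k, (k <= j)%N -> `|s - k%:R * u - t0| < e) ->
  `|x - y (s - j%:R * u)| <= expR (C * (j%:R * `|u|)) *
    (`|iter j (euler a u) x - y s| + C * (j%:R * `|u| ^+ 2)).
Proof.
have [C C0 HC] := curve_consistent; have [L L0 HL] := vfield_lipschitz.
exists (2 * L + C); split=> [|u Lu]; first by rewrite addr_ge0// mulr_ge0.
have Lu2 : L * `|u| <= 1 / 2.
  rewrite ler_pdivlMr// (le_trans _ Lu)// mulrDl mulrAC [L * 2]mulrC.
  by rewrite lerDl mulr_ge0.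
have LC0 : 0 <= 2 * L + C by rewrite addr_ge0// mulr_ge0.
elim=> [|j IH] x s sj.
  by rewrite !mul0r subr0 !mulr0 expR0 mul1r addr0.
set t := s - _.
have tu : t + u = s - j%:R * u by rewrite /t -[j.+1%:R]natr1; ring.
have te : `|t - t0| < e by apply: sj.
have tue : `|t + u - t0| < e by rewrite tu; exact: sj.
have := IH (euler a u x) s (fun k kj => sj k (leqW kj)).
rewrite -iterSr -tu; set d := `|iter j.+1 _ _ - _|; move=> H.
have H1 : `|x - y t| * (1 - L * `|u|) <= `|euler a u x - y (t + u)| + C * `|u| ^+ 2.
  have := HC t u te tue => H2.
  have H3 : `|x - y t| <= `|euler a u x - euler a u (y t)| + `|u| * (L * `|x - y t|).
    have -> : x - y t = (euler a u x - euler a u (y t)) - u *: (vfield a x - vfield a (y t)).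
      by apply/rowP => i; rewrite !mxE; ring.
    rewrite (le_trans (ler_normB _ _))// lerD2l normrZ.
    have -> : (euler a u x - euler a u (y t)) - u *: (vfield a x - vfield a (y t)) = x - y t.
      by apply/rowP => i; rewrite !mxE; ring.
    by rewrite ler_wpM2l.
  have H4 : `|euler a u x - euler a u (y t)| <= `|euler a u x - y (t + u)| + C * `|u| ^+ 2.
    have -> : euler a u x - euler a u (y t) =
      (euler a u x - y (t + u)) - (euler a u (y t) - y (t + u)).
      by rewrite opprB addrA subrK.
    by rewrite (le_trans (ler_normB _ _))// lerD2l.
  have -> : `|x - y t| * (1 - L * `|u|) = `|x - y t| - `|u| * (L * `|x - y t|) by ring.
  by rewrite lerBlDr (le_trans H3)// lerD2r.
set w := C * `|u| ^+ 2 in H1; have w0 : 0 <= w by rewrite mulr_ge0// exprn_ge0.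
set q := expR _ in H; set D := 2 * L + C in H LC0 *.
have w' : w <= D * `|u| ^+ 2 by rewrite ler_wpM2r ?exprn_ge0// /D lerDr mulr_ge0.
have q1 : 1 <= q by rewrite -expR0 ler_expR !mulr_ge0.
have d0 : 0 <= d by exact: normr_ge0.
(* divide H1 by 1 - L |u|, which is at least 1 / 2 *)
have H5 : `|x - y t| <= (1 + 2 * (L * `|u|)) * (`|euler a u x - y (t + u)| + w).
  have p0 : 0 < 1 + 2 * (L * `|u|) by rewrite ltr_pwDl// !mulr_ge0.
  apply: le_trans (ler_wpM2l (ltW p0) H1).
  rewrite mulrCA ler_peMr//.
  have v0 : 0 <= L * `|u| by rewrite mulr_ge0.
  by nra.
apply: (le_trans H5).
have -> : expR (D * (j.+1%:R * `|u|)) = expR (D * `|u|) * q.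
  rewrite /q -expRD.
  by congr (expR _); rewrite /D -natr1; ring.
rewrite -mulrA; apply: ler_pM.
- by rewrite addr_ge0// !mulr_ge0.
- by rewrite addr_ge0.
- apply: le_trans (expR_ge1Dx _); rewrite lerD2l mulrA ler_wpM2r// /D lerDl//.
apply: (le_trans (lerD H w')).
have -> : d + D * (j.+1%:R * `|u| ^+ 2) = (d + D * (j%:R * `|u| ^+ 2)) + D * `|u| ^+ 2.
  by rewrite -[j.+1%:R]natr1; ring.
by rewrite [q * (_ + _ * _ ^+ 2)]mulrDr lerD2l ler_peMl// mulr_ge0// exprn_ge0.
Qed.

End Tracking.

(** * Smooth bump functions *)

Section DeriveComp.
Context {R : realType}.

Lemma is_derive_comp1 (W : normedModType R) (F : R -> R) (q : W -> R) (x v : W) (dF dq : R) :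
  is_derive (q x) (1 : R) F dF -> is_derive x v q dq ->
  is_derive x v (F \o q) (dF * dq).
Proof.
move=> HF /is_derive_line Hq; apply/is_derive_line.
pose p (h : R) := q (h *: v + x).
have HF' : is_derive (p 0) (1 : R) F dF by rewrite /p scale0r add0r.
exact: (@is_derive1_comp _ F p 0 dF dq HF' Hq).
Qed.

(** Meant for differentiation under the integral sign and at the points where a
    function defined by cases changes formula. *)
Lemma is_derive_quadratic (W : normedModType R) (f : W -> R) (x v : W) (d C : R) :
  (forall h, `|h| <= 1 -> `|f (h *: v + x) - f x - h * d| <= C * h ^+ 2) ->
  is_derive x v f d.
Proof.
move=> H; pose g (h : R) := h^-1 *: ((f \o shift x) (h *: v) - f x).
suff G : g h @[h --> 0^'] --> d.
  split; [by apply/cvg_ex; exists d|exact: cvg_lim G].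
apply/cvgrPdist_le => e e0.
have k0 : 0 < `|C| + 1 by rewrite ltr_wpDl.
near=> h.
have h0 : h != 0 by near: h; exact: nbhs_dnbhs_neq.
have h1 : `|h| <= 1 by near: h; exact: dnbhs0_le.
have he : `|h| <= e / (`|C| + 1) by near: h; apply: dnbhs0_le; rewrite divr_gt0.
rewrite distrC /g /=.
have -> : h^-1 *: (f (h *: v + x) - f x) - d = h^-1 * (f (h *: v + x) - f x - h * d).
  by rewrite mulrBr mulKf.
rewrite normrM normfV ler_pdivrMl ?normr_gt0//.
rewrite (le_trans (H h h1))// -real_normK ?num_real// expr2 mulrCA ler_wpM2l//.
rewrite (le_trans (ler_wpM2r _ (ler_norm C)))//.
rewrite (@le_trans _ _ (`|C| * (e / (`|C| + 1))))//; first by rewrite ler_wpM2l.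
by rewrite mulrCA ger_pMr// ler_pdivrMr// mul1r lerDl.
Unshelve. all: by end_near. Qed.

End DeriveComp.

Section FlatFunction.
Context {R : realType}.
Implicit Types (t : R) (k : nat).

(** The derivatives of exp(-1/t), extended by 0, are linear combinations of
    these functions, which all vanish to infinite order at 0. *)
Definition flat k t : R := if 0 < t then (t^-1) ^+ k * expR (- t^-1) else 0.

Lemma flat_le0 k t : t <= 0 -> flat k t = 0.
Proof. by rewrite /flat leNgt => /negPf ->. Qed.

Lemma flat_gt0 k t : 0 < t -> 0 < flat k t.
Proof. by move=> t0; rewrite /flat t0 mulr_gt0 ?expR_gt0// exprn_gt0 ?invr_gt0. Qed.

Lemma flat_ge0 k t : 0 <= flat k t.
Proof. by case: (ltP 0 t) => [/(flat_gt0 k)/ltW//|t0]; rewrite flat_le0. Qed.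

Lemma expR_pow_bound m (y : R) : 0 <= y -> y ^+ m.+1 * expR (- y) <= m.+1`!%:R.
Proof.
move=> y0; rewrite expRN ler_pdivrMr ?expR_gt0// mulrC -ler_pdivrMr ?ltr0n ?fact_gt0//.
by apply: le_trans (expR_ge1Dxn m y0); rewrite lerDr.
Qed.

Lemma flat_quadratic k t : flat k t <= k.+2`!%:R * t ^+ 2.
Proof.
have [t0|t0] := ltP 0 t; last by rewrite flat_le0// mulr_ge0// sqr_ge0.
rewrite {1}/flat t0 -ler_pdivrMr ?exprn_gt0//.
have := @expR_pow_bound k.+1 t^-1; rewrite invr_ge0 ltW// => /(_ isT).
apply: le_trans; rewrite -exprVn mulrAC -exprD addn2//.
Qed.

Lemma flat_is_derive k t :
  is_derive t (1 : R) (flat k) (flat k.+2 t - k%:R * flat k.+1 t).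
Proof.
have [t0|t0|t0] := ltgtP t 0.
- rewrite !flat_le0 ?ltW// mulr0 subrr.
  apply: (near_eq_is_derive (f := fun=> 0)).
  near=> s; rewrite flat_le0// ltW//; near: s; exact: lt_nbhsl.
- have tn0 : t != 0 by rewrite gt_eqF.
  have N : \near t, (fun s : R => (s^-1) ^+ k * expR (- s^-1)) t = flat k t.
    near=> s; rewrite /flat ifT//; near: s; exact: lt_nbhsr.
  have D1 : is_derive t (1 : R) (fun s : R => s^-1) (- t ^- 2).
    have := @is_deriveV _ id t 1 1 tn0 (is_derive_id _ _).
    by rewrite [_%:A]mulr1.
  pose P := (fun u : R => u ^+ k) * (fun u : R => expR (- u)).
  have D2 : is_derive t^-1 (1 : R) P
      (k%:R * t^-1 ^+ k.-1 * expR (- t^-1) - t^-1 ^+ k * expR (- t^-1)).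
    have d1 := @is_deriveX R R (@id R) k t^-1 1 1 (is_derive_id _ _).
    have d2 := is_derive_comp1 (is_derive_expR (- t^-1)) (is_deriveNid t^-1 (1:R)).
    have E : id ^+ k = (fun u : R => u ^+ k).
      by apply/funext => u; elim: (k) => [|l IH]; rewrite ?expr0// !exprS -IH.
    rewrite E in d1; apply: (is_derive_eq (is_deriveM d1 d2)).
    by rewrite /GRing.scale/= !mulr1 mulrN1; ring.
  apply: (near_eq_is_derive N).
  apply: (is_derive_eq (is_derive_comp1 D2 D1)).
  rewrite /flat t0 -exprVn; move: (expR _) => e.
  by case: (k) => [|l] /=; rewrite !exprS; ring.
- rewrite t0 !flat_le0// mulr0 subrr.
  apply: (is_derive_quadratic (C := k.+2`!%:R)) => h _.
  rewrite [_%:A]mulr1 addr0 mulr0 !subr0 [flat k 0]flat_le0// subr0.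
  by rewrite ger0_norm ?flat_ge0// flat_quadratic.
Unshelve. all: by end_near. Qed.

Lemma flat_continuous k : continuous (flat k).
Proof.
move=> t; apply: differentiable_continuous; apply/derivable1_diffP.
by have [] := flat_is_derive k t.
Qed.

End FlatFunction.

Section FlatComp.
Context {R : realType} {n : nat}.

(** The span of the functions flat k is closed under differentiation, hence the
    induction on the order of differentiability for all k together. *)
Lemma smooth_flat (U : set 'rV[R]_n) (q : 'rV[R]_n -> R) k : open U ->
  smooth_on U q -> smooth_on U (fun x => flat k (q x)).
Proof.
move=> oU qs; apply/smooth_onP => l; elim: l k => [|l IH] k.
  move=> s; rewrite leqn0 size_eq0 => /eqP -> x Ux.
  have [qc qd] := qs [::] x Ux; split => [|i].
    exact: (continuous_comp qc (@flat_continuous R k (q x))).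
  by have [] := is_derive_comp1 (flat_is_derive k (q x)) (derivableP (qd i)).
have C1 : C1_data U (fun x => flat k (q x)).
  exact: (IH k [::] (leq0n _)).
apply: (CuptoS C1) => i.
have E : {in U, (fun x => (flat k.+2 (q x) + - k%:R * flat k.+1 (q x)) * partial i q x) =1
    partial i (fun x => flat k (q x))}.
  move=> x /[!inE] Ux; have [_ /(_ i) qd] := qs [::] x Ux.
  have [_ d] := is_derive_comp1 (flat_is_derive k (q x)) (derivableP qd).
  by rewrite mulNr; exact: esym d.
apply: (eq_Cupto oU E).
have A1 := CuptoM oU (Cupto_cst (- k%:R) oU (k := l)) (IH k.+1).
exact: (CuptoM oU (CuptoD oU (IH k.+2) A1) (smooth_Cupto (smooth_on_partial i qs))).
Qed.

(** Positive exactly on the open ball of radius r around p: balls for the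
    supremum norm are cubes, so a product over the coordinates will do. *)
Definition bump (p : 'rV[R]_n) (r : R) (x : 'rV[R]_n) : R :=
  \prod_(i < n) (flat 0 (r - (x 0 i - p 0 i)) * flat 0 (r + (x 0 i - p 0 i))).

(** Positive exactly outside of the closed ball of radius r around p. *)
Definition cobump (p : 'rV[R]_n) (r : R) (x : 'rV[R]_n) : R :=
  \sum_(i < n) (flat 0 (x 0 i - p 0 i - r) + flat 0 (- (x 0 i - p 0 i) - r)).

Let smooth_diff (p : 'rV[R]_n) i : smooth_on setT (fun x : 'rV[R]_n => x 0 i - p 0 i).
Proof. exact: (smoothB openT (smooth_coord i openT) (smooth_on_cst _ openT)). Qed.

Lemma smooth_bump p r : smooth_on setT (bump p r).
Proof.
apply: (smooth_prod openT) => i.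
have c := @smooth_on_cst R n setT r openT.
have s1 := smoothB openT c (smooth_diff p i).
have s2 := smoothD openT c (smooth_diff p i).
exact: (smoothM openT (smooth_flat 0 openT s1) (smooth_flat 0 openT s2)).
Qed.

Lemma smooth_cobump p r : smooth_on setT (cobump p r).
Proof.
apply: (smooth_sum openT) => i.
have c := @smooth_on_cst R n setT r openT.
have s1 := smoothB openT (smooth_diff p i) c.
have s2 := smoothB openT (smoothN openT (smooth_diff p i)) c.
exact: (smoothD openT (smooth_flat 0 openT s1) (smooth_flat 0 openT s2)).
Qed.

Lemma bump_ge0 p r x : 0 <= bump p r x.
Proof. by apply: prodr_ge0 => i _; rewrite mulr_ge0// flat_ge0. Qed.

Lemma cobump_ge0 p r x : 0 <= cobump p r x.
Proof. by apply: sumr_ge0 => i _; rewrite addr_ge0// flat_ge0. Qed.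

Lemma bump_gt0 p r x : `|x - p| < r -> 0 < bump p r x.
Proof.
move=> xr; apply: prodr_gt0 => i _.
have := ler_norm_coord (x - p) i; rewrite !mxE => /le_lt_trans/(_ xr).
rewrite ltr_norml => /andP[h1 h2].
by rewrite mulr_gt0// flat_gt0// ?subr_gt0// -(opprK r) addrC subr_gt0.
Qed.

Lemma bump_eq0 p r x : 0 < r -> r <= `|x - p| -> bump p r x = 0.
Proof.
move=> r0 rx; apply/eqP; apply: contraTT rx => /prodf_neq0 H; rewrite -ltNge.
apply: rV_norm_lt => // i; have := H i isT; rewrite !mxE/= mulf_eq0 negb_or => /andP[h1 h2].
rewrite ltr_norml; apply/andP; split; rewrite ltNge; apply/negP => h.
  move: h2; rewrite flat_le0 ?eqxx//.
  by rewrite addrC -lerBrDr sub0r.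
by move: h1; rewrite flat_le0 ?eqxx// subr_le0.
Qed.

Lemma cobump_eq0 p r x : `|x - p| <= r -> cobump p r x = 0.
Proof.
move=> xr; apply: big1 => i _.
have := ler_norm_coord (x - p) i; rewrite !mxE => /le_trans/(_ xr).
rewrite ler_norml => /andP[h1 h2].
by rewrite !flat_le0 ?addr0// subr_le0// lerNl.
Qed.

Lemma cobump_gt0 p r x : 0 <= r -> r < `|x - p| -> 0 < cobump p r x.
Proof.
move=> r0 rx; rewrite lt_neqAle cobump_ge0 andbT eq_sym.
apply/eqP => /eqP; rewrite psumr_eq0 => [|i _]; last by rewrite addr_ge0 ?flat_ge0.
move=> /allP H; move: rx; rewrite ltNge => /negP; apply.
apply: rV_norm_le => // i; have := H i (mem_index_enum i).
rewrite !mxE/= paddr_eq0 ?flat_ge0// => /andP[/eqP h1 /eqP h2].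
rewrite ler_norml; apply/andP; split; rewrite leNgt; apply/negP => h.
  by have := @flat_gt0 R 0 (- (x 0 i - p 0 i) - r); rewrite h2 ltxx subr_gt0 ltrNr => /(_ h).
by have := @flat_gt0 R 0 (x 0 i - p 0 i - r); rewrite h1 ltxx subr_gt0 => /(_ h).
Qed.

(** Equal to 1 on the ball of radius r and to 0 outside of the one of radius
    2 r. *)
Definition plateau p r x : R := bump p (2 * r) x / (bump p (2 * r) x + cobump p r x).

Lemma plateau_den_gt0 p r x : 0 < r -> 0 < bump p (2 * r) x + cobump p r x.
Proof.
move=> r0; have [xr|rx] := leP `|x - p| r.
  by rewrite ltr_wpDr ?cobump_ge0// bump_gt0// (le_lt_trans xr)// mulr_natl mulr2n ltrDl.
by rewrite ltr_wpDl ?bump_ge0// cobump_gt0// ltW.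
Qed.

Lemma smooth_plateau p r : 0 < r -> smooth_on setT (plateau p r).
Proof.
move=> r0; have b := smooth_bump p (2 * r).
have d := smoothD openT b (smooth_cobump p r).
apply: (smoothM openT b); apply: (smoothV openT _ d) => x _.
by rewrite gt_eqF// plateau_den_gt0.
Qed.

Lemma plateau_eq1 p r x : 0 < r -> `|x - p| <= r -> plateau p r x = 1.
Proof.
move=> r0 xr; rewrite /plateau cobump_eq0// addr0 mulfV// gt_eqF// bump_gt0//.
by rewrite (le_lt_trans xr)// mulr_natl mulr2n ltrDl.
Qed.

Lemma plateau_eq0 p r x : 0 < r -> 2 * r <= `|x - p| -> plateau p r x = 0.
Proof. by move=> r0 rx; rewrite /plateau bump_eq0 ?mul0r// mulr_gt0. Qed.

End FlatComp.

(** * Hadamard's lemma *)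

Section UnitIntegral.
Context {R : realType}.
Implicit Types f g : R -> R.

Definition int01 f : R :=
  Rintegral (@lebesgue_measure R) `[0, 1] f.

Lemma continuous_integrable01 f : continuous f ->
  (@lebesgue_measure R).-integrable `[0, 1] (EFin \o f).
Proof.
move=> fc; apply: continuous_compact_integrable; first exact: segment_compact.
exact: continuous_subspaceT.
Qed.

Lemma int01B f g : continuous f -> continuous g ->
  int01 (fun t => f t - g t) = int01 f - int01 g.
Proof. by move=> fc gc; apply: RintegralB => //; exact: continuous_integrable01. Qed.

Lemma int01Z (c : R) f : continuous f -> int01 (fun t => c * f t) = c * int01 f.
Proof. by move=> fc; apply: RintegralZl => //; exact: continuous_integrable01. Qed.

Lemma int01D f g : continuous f -> continuous g ->
  int01 (fun t => f t + g t) = int01 f + int01 g.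
Proof. by move=> fc gc; apply: RintegralD => //; exact: continuous_integrable01. Qed.

Lemma int01_le f (B : R) : continuous f ->
  (forall t, 0 <= t <= 1 -> `|f t| <= B) -> `|int01 f| <= B.
Proof.
move=> fc fB; have i := continuous_integrable01 fc.
have H : `|int01 f| <= int01 (fun t => `|f t|) by apply: le_normr_Rintegral.
apply: (le_trans H); have -> : B = int01 (fun=> B).
  rewrite /int01 Rintegral_cst//= lebesgue_measure_itv/= lte_fin ltr01.
  by rewrite -EFinB/= subr0 mulr1.
apply: le_Rintegral => //.
- have := @continuous_integrable01 (fun t => `|f t|); apply => t.
  exact: (continuous_comp (fc t) (@norm_continuous _ _ _)).
- by apply: continuous_integrable01 => t; exact: cst_continuous.
Qed.

Lemma int01_ext f g : f =1 g -> int01 f = int01 g.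
Proof. by move=> /funext ->. Qed.

Lemma mul_is_derive (c t : R) : is_derive t (1 : R) (fun s => s * c) c.
Proof.
have d := @is_deriveM _ _ id (cst c) t 1 1 0 (is_derive_id _ _) (is_derive_cst _ _ _).
by apply: (is_derive_eq d); rewrite scaler0 add0r; exact: mulr1.
Qed.

Lemma int01_FTC f F : continuous f ->
  (forall t : R, is_derive t (1 : R) F (f t)) -> int01 f = F 1 - F 0.
Proof.
move=> fc Fd; have Fc : continuous F.
  move=> t; apply: differentiable_continuous; apply/derivable1_diffP.
  by have [] := Fd t.
rewrite /int01 /Rintegral (@continuous_FTC2 _ f F)//.
- exact: continuous_subspaceT.
- split => [t _||]; first by have [] := Fd t.
    exact: (cvg_at_right_filter (Fc 0)).
  exact: (cvg_at_left_filter (Fc 1)).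
- by move=> t _; rewrite derive1E; have [_] := Fd t.
Qed.

End UnitIntegral.

Section Hadamard.
Context {R : realType} {n : nat}.
Variable q : 'rV[R]_n.
Implicit Types (F G : 'rV[R]_n -> R).

Definition ray (x : 'rV[R]_n) (t : R) : 'rV[R]_n := q + t *: (x - q).

Definition ray_integrand k F x (t : R) := t ^+ k * F (ray x t).

(** The weights t^k appear because each derivative in x of F (q + t (x - q))
    brings out a factor t; with them the family is closed under
    differentiation. *)
Definition ray_mean k F x : R := int01 (ray_integrand k F x).

Lemma ray_continuous x : continuous (ray x).
Proof.
move=> t; apply: cvgD; first exact: cvg_cst.
by apply: cvgZr_tmp; exact: cvg_id.
Qed.

Lemma ray_integrand_continuous k F x : smooth_on setT F ->
  continuous (ray_integrand k F x).
Proof.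
move=> Fs t; apply: cvgM; first exact: exprn_continuous.
have [Fc _] := Fs [::] (ray x t) I.
exact: (continuous_comp (@ray_continuous x t) Fc).
Qed.

Lemma ray_add x h t : ray (x + h) t = ray x t + t *: h.
Proof. by rewrite /ray addrAC scalerDr addrA. Qed.

Definition all_bounded F := forall r, exists B, dbound setT r F B.

Lemma all_bounded_partial F i : all_bounded F -> all_bounded (partial i F).
Proof.
by move=> FB r; have [B HB] := FB r.+1; exists B; exact: dbound_partial.
Qed.

Lemma ray_mean_continuous k F : smooth_on setT F -> all_bounded F ->
  continuous (ray_mean k F).
Proof.
move=> Fs FB x; have [B HB] := FB 1%N; have B0 := dbound_ge0 HB.
have Bn0 : 0 < B * n%:R + 1 by rewrite ltr_wpDl// mulr_ge0.
apply/(@cvgrPdist_le _ _ _ (nbhs x)) => e e0; near=> y.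
have c z : continuous (ray_integrand k F z) by exact: ray_integrand_continuous.
rewrite distrC /ray_mean -(int01B (c y) (c x)); apply: int01_le.
  by move=> t; apply: cvgB; exact: c.
move=> t /andP[t0 t1]; rewrite /ray_integrand -mulrBr normrM.
have -> : ray y t = ray x t + t *: (y - x) by rewrite -ray_add addrC subrK.
have N : `|x - y| <= e / (B * n%:R + 1).
  by near: y; apply: cvgr_dist_le => //; rewrite divr_gt0.
apply: (@le_trans _ _ (1 * (B * n%:R * `|x - y|))).
  apply: ler_pM => //.
    by rewrite ger0_norm ?exprn_ge0// exprn_ile1.
  have H := increment_bound Fs HB (ray x t) (t *: (y - x)); apply: (le_trans H).
  rewrite ler_wpM2l ?mulr_ge0// normrZ distrC ger0_norm// ler_piMl//.
rewrite mul1r (@le_trans _ _ (B * n%:R * (e / (B * n%:R + 1))))//.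
  by rewrite ler_wpM2l// mulr_ge0.
by rewrite mulrCA ger_pMr// ler_pdivrMr// mul1r lerDl.
Unshelve. all: by end_near. Qed.

(** Differentiation under the integral sign: the remainder of the first order
    expansion is bounded uniformly in t because F has bounded second
    derivatives. *)
Lemma ray_mean_is_derive k F x j : smooth_on setT F -> all_bounded F ->
  is_derive x ('e_j) (ray_mean k F) (ray_mean k.+1 (partial j F) x).
Proof.
move=> Fs FB; have [B HB] := FB 2; have B0 := dbound_ge0 HB.
have c l z : continuous (ray_integrand l F z) by exact: ray_integrand_continuous.
have c' l z : continuous (ray_integrand l (partial j F) z).
  exact: (ray_integrand_continuous (smooth_on_partial j Fs)).
apply: (is_derive_quadratic (C := B * n%:R * n%:R)) => h h1.
rewrite /ray_mean -(int01Z h (c' _ _)) -(int01B (c _ _) (c _ _)).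
have cd : continuous (fun t => ray_integrand k F (h *: 'e_j + x) t - ray_integrand k F x t).
  by move=> t; apply: cvgB; exact: c.
have ch : continuous (fun t => h * ray_integrand k.+1 (partial j F) x t).
  by move=> t; apply: cvgMl_tmp; exact: c'.
rewrite -(int01B cd ch); apply: int01_le.
  by move=> t; apply: cvgB; [exact: cd|exact: ch].
move=> t /andP[t0 t1]; rewrite /ray_integrand [h *: _ + x]addrC ray_add scalerA.
have -> : t ^+ k * F (ray x t + (t * h) *: 'e_j) - t ^+ k * F (ray x t) -
    h * (t ^+ k.+1 * partial j F (ray x t)) =
  t ^+ k * (F (ray x t + (t * h) *: 'e_j) - F (ray x t) - (t * h) * partial j F (ray x t)).
  by rewrite exprS; ring.
have := increment2_bound Fs HB (ray x t) ((t * h) *: 'e_j).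
rewrite (bigD1 j)//= !mxE !eqxx mulr1 big1 ?addr0; last first.
  by move=> l lj; rewrite !mxE (negPf lj) andbF mulr0 mulr0.
rewrite [partial j F _ * _]mulrC => H.
rewrite normrM -[leRHS]mul1r; apply: ler_pM => //.
  by rewrite ger0_norm ?exprn_ge0// exprn_ile1.
apply: (le_trans H); rewrite ler_wpM2l ?mulr_ge0//.
rewrite -[h ^+ 2]real_normK ?num_real// ler_pXn2r// ?nnegrE//.
rewrite normrZ normrM (ger0_norm t0) (@le_trans _ _ (t * `|h|))//.
  by rewrite ler_piMr ?mulr_ge0// norm_e_le1.
by rewrite ler_piMl.
Qed.

Lemma smooth_ray_mean k F : smooth_on setT F -> all_bounded F ->
  smooth_on setT (ray_mean k F).
Proof.
move=> Fs FB; apply/smooth_onP => l; elim: l k F Fs FB => [|l IH] k F Fs FB.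
  move=> s; rewrite leqn0 size_eq0 => /eqP -> x _; split=> [|i].
    exact: ray_mean_continuous.
  by have [] := ray_mean_is_derive k x i Fs FB.
have C1 : C1_data setT (ray_mean k F) by exact: (IH k F Fs FB [::] (leq0n _)).
apply: (CuptoS C1) => i.
have -> : partial i (ray_mean k F) = ray_mean k.+1 (partial i F).
  by apply/funext => x; have [_ E] := ray_mean_is_derive k x i Fs FB; exact: E.
exact: (IH _ _ (smooth_on_partial i Fs) (all_bounded_partial i FB)).
Qed.

(** F x - F q is the integral of the derivative of F along the segment from q to
    x, so the means of the partial derivatives of F over this segment will do. *)
Lemma hadamard F : smooth_on setT F -> all_bounded F ->
  exists h : 'I_n -> 'rV[R]_n -> R,
    [/\ forall i, smooth_on setT (h i), forall i, h i q = partial i F q &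
        forall x, F x = F q + \sum_i (x 0 i - q 0 i) * h i x].
Proof.
move=> Fs FB; exists (fun i => ray_mean 0 (partial i F)); split.
- by move=> i; apply: smooth_ray_mean; [exact: smooth_on_partial|exact: all_bounded_partial].
- move=> i; rewrite /ray_mean (@int01_ext _ _ (fun=> partial i F q)); last first.
    by move=> t; rewrite /ray_integrand /ray subrr scaler0 addr0 expr0 mul1r.
  have cc : continuous (fun _ : R => partial i F q) by move=> t; exact: cst_continuous.
  by rewrite (int01_FTC cc (mul_is_derive _)) mul1r mul0r subr0.
move=> x; apply/eqP; rewrite addrC -subr_eq; apply/eqP.
have c i : continuous (ray_integrand 0 (partial i F) x).
  exact: (ray_integrand_continuous (smooth_on_partial i Fs)).
have rayd (t : R) i : is_derive t (1 : R) (fun s => ray x s 0 i) (x 0 i - q 0 i).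
  have -> : (fun s => ray x s 0 i) = (fun s => q 0 i + s * (x 0 i - q 0 i)).
    by apply/funext => s; rewrite !mxE.
  by apply: (is_derive_eq (is_deriveD (is_derive_cst (q 0 i) t (1:R)) (mul_is_derive _ t)));
    rewrite add0r.
pose f (t : R) := \sum_i (x 0 i - q 0 i) * partial i F (ray x t).
have fE : f = fun t => \sum_i (x 0 i - q 0 i) * ray_integrand 0 (partial i F) x t.
  by apply/funext => t; apply: eq_bigr => i _; rewrite /ray_integrand expr0 mul1r.
have fc : continuous f.
  by rewrite fE => t; apply: (@cvg_sumr _ _ (nbhs t)) => i; apply: cvgMl_tmp; exact: c.
have Fd t : is_derive t (1 : R) (fun t => F (ray x t)) (f t).
  exact: (chain_is_derive openT I (smooth_Cupto Fs) (rayd t)).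
have := int01_FTC fc Fd.
have -> : F (ray x 1) = F x by rewrite /ray scale1r addrC subrK.
have -> : F (ray x 0) = F q by rewrite /ray scale0r addr0.
move=> <-; rewrite fE /ray_mean; elim: (index_enum _) => [|i s IH].
  rewrite big_nil (@int01_ext _ _ (fun t => 0 * 1)) ?int01Z ?mul0r//.
    by move=> t; exact: cst_continuous.
  by move=> t; rewrite big_nil.
rewrite big_cons (@int01_ext _ _ (fun t => (x 0 i - q 0 i) * ray_integrand 0 (partial i F) x t +
  \sum_(j <- s) (x 0 j - q 0 j) * ray_integrand 0 (partial j F) x t)); last first.
  by move=> t; rewrite big_cons.
have ci : continuous (fun t => (x 0 i - q 0 i) * ray_integrand 0 (partial i F) x t).
  by move=> t; apply: cvgMl_tmp; exact: c.
have cs : continuous (fun t => \sum_(j <- s) (x 0 j - q 0 j) * ray_integrand 0 (partial j F) x t).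
  by move=> t; apply: (@cvg_sumr _ _ (nbhs t)) => j; apply: cvgMl_tmp; exact: c.
by rewrite (int01D ci cs) IH (int01Z _ (c i)).
Qed.

End Hadamard.

(** * Functions supported in a chart *)

Section CompactSupport.
Context {R : realType} {n : nat}.
Implicit Types (U K : set 'rV[R]_n) (g : 'rV[R]_n -> R).

Definition supp_in K g := forall x, ~ K x -> g x = 0.

Lemma compact_dbound U K g r : open U -> K `<=` U -> compact K ->
  smooth_on U g -> exists2 A, 0 <= A & dbound K r g A.
Proof.
move=> oU KU cK; elim: r g => [|r IH] g gs.
  have [->|K0] := eqVneq K set0; first by exists 0.
  have c : {within K, continuous (fun x => `|g x|)}.
    apply: continuous_in_subspaceT => x /[!inE] Kx.
    have [gc _] := gs [::] x (KU x Kx).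
    exact: (continuous_comp gc (@norm_continuous _ _ _)).
  have [x xK H] := compact_EVT_max ((set0P K).1 K0) cK c.
  exists `|g x|; first exact: normr_ge0.
  by move=> s; rewrite leqn0 size_eq0 => /eqP -> z Kz; apply: H; rewrite inE.
have [A A0 HA] := IH g gs.
have [B B0 HB] : exists2 B, 0 <= B & forall i, dbound K r (partial i g) B.
  by apply: dbound_finite => i; apply: IH; exact: smooth_on_partial.
exists (A + B); first exact: addr_ge0.
apply: dbound_cons => [x Kx|i].
  by rewrite (le_trans (dbound0 HA Kx))// lerDl.
by apply: dbound_le (HB i); rewrite lerDr.
Qed.

Lemma partials_cst0 s : partials s (fun _ : 'rV[R]_n => 0 : R) = fun=> 0.
Proof. by elim: s => [//|i s IH] /=; rewrite partial_cst. Qed.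

Lemma partials_supp0 U s g : open U -> (forall x, U x -> g x = 0) ->
  forall x, U x -> partials s g x = 0.
Proof.
move=> oU g0 x Ux; have E : {in U, g =1 fun=> 0} by move=> y /[!inE]; exact: g0.
by rewrite (eq_partials s oU E) ?inE// partials_cst0.
Qed.

(** On K this is compactness, and all derivatives vanish on the complement of K,
    which is open. *)
Lemma compact_supp_bounded K g : compact K -> smooth_on setT g -> supp_in K g ->
  all_bounded g.
Proof.
move=> cK gs gK r; have [A A0 HA] := compact_dbound r openT (@subsetT _ _) cK gs.
exists A => s sr x _; have [Kx|NKx] := pselect (K x); first exact: HA.
have oK : open (~` K).
  exact: (closed_openC (compact_closed (@norm_hausdorff _ _) cK)).
by rewrite (partials_supp0 s oK gK NKx) normr0.
Qed.

Definition zero_ext U g : 'rV[R]_n -> R := fun x => if `[< U x >] then g x else 0.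

Lemma smooth_zero_ext U K g : open U -> closed K -> K `<=` U ->
  (forall x, U x -> ~ K x -> g x = 0) -> smooth_on U g ->
  smooth_on setT (zero_ext U g).
Proof.
move=> oU cK KU g0 gs; apply: smooth_on_local => x _.
have [Ux|NUx] := pselect (U x).
  exists U; split; [exact: oU|exact: Ux|apply: (eq_smooth_on oU _ gs) => y /[!inE] Uy].
  by rewrite /zero_ext asboolT.
have oK := closed_openC cK.
exists (~` K); split=> //; first by move=> /KU.
apply: (eq_smooth_on oK _ (smooth_on_cst 0 oK)) => y /[!inE] NKy.
by rewrite /zero_ext; case: asboolP => // Uy; rewrite g0.
Qed.

End CompactSupport.

Section Charts.
Context {R : realType} {n : nat} (M : smooth_manifold R n).
Implicit Types (c d : chart R n M) (g : 'rV[R]_n -> R).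

Lemma open_preim d (O : set M) : open O ->
  open (chart_im d `&` chart_inv d @^-1` O).
Proof.
move=> oO; rewrite openE => z [dz Oz].
rewrite /interior; apply: filterI.
  exact: (open_nbhs_nbhs (conj (@chart_im_open _ _ _ d) dz)).
have := @chart_inv_continuous _ _ _ d z; rewrite inE => /(_ dz); apply.
exact: open_nbhs_nbhs.
Qed.

Lemma open_chart_preim c (O : set 'rV[R]_n) : open O ->
  open (chart_dom c `&` chart_map c @^-1` O).
Proof.
move=> oO; rewrite openE => z [dz Oz].
rewrite /interior; apply: filterI.
  exact: (open_nbhs_nbhs (conj (@chart_dom_open _ _ _ c) dz)).
have := @chart_map_continuous _ _ _ c z; rewrite inE => /(_ dz); apply.
exact: open_nbhs_nbhs.
Qed.

Lemma chart_inv_dom c z : chart_im c z -> chart_dom c (chart_inv c z).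
Proof. by move=> [x cx <-]; rewrite (@chart_mapK _ _ _ c) ?inE. Qed.

Lemma chart_invK c z : chart_im c z -> chart_map c (chart_inv c z) = z.
Proof. by move=> [x cx <-]; rewrite (@chart_mapK _ _ _ c) ?inE. Qed.

Lemma chart_mapP c x : chart_dom c x -> chart_im c (chart_map c x).
Proof. by move=> cx; exists x. Qed.

Lemma chart_inv_map c x : chart_dom c x -> chart_inv c (chart_map c x) = x.
Proof. by move=> cx; rewrite (@chart_mapK _ _ _ c) ?inE. Qed.

Definition lift c g : M -> R :=
  fun x => if `[< chart_dom c x >] then g (chart_map c x) else 0.

Section Lift.
Variables (c : chart R n M) (K : set 'rV[R]_n).
Hypotheses (Mc : mfd_atlas c) (cK : compact K) (Kc : K `<=` chart_im c).

Let C := chart_inv c @` K.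

Let C_closed : closed C.
Proof.
apply: (compact_closed (@mfd_hausdorff _ _ M)).
apply: continuous_compact => //; apply: continuous_in_subspaceT => z /[!inE] Kz.
by apply: chart_inv_continuous; rewrite inE; exact: Kc.
Qed.

Let W1 d := chart_im d `&` chart_inv d @^-1` (chart_dom c).
Let W2 d := chart_im d `&` chart_inv d @^-1` (~` C).

Let oW1 d : open (W1 d).
Proof. rewrite /W1; apply: open_preim; exact: chart_dom_open. Qed.

Let oW2 d : open (W2 d).
Proof. rewrite /W2; apply: open_preim; exact: (closed_openC C_closed). Qed.

Let C_dom x : C x -> chart_dom c x.
Proof. by move=> [z Kz <-]; apply: chart_inv_dom; exact: Kc. Qed.

Let psi d := chart_map c \o chart_inv d.

Let psi_smooth d : mfd_atlas d -> forall j, smooth_on (W1 d) (fun x => psi d x 0 j).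
Proof.
move=> Md j; apply: smooth_on_subset (mfd_compatible Md Mc j) => z [dz cz] /=.
by exists (chart_inv d z); [split=> //; exact: chart_inv_dom|exact: chart_invK].
Qed.

Let liftW1 d g : {in W1 d, g \o psi d =1 lift c g \o chart_inv d}.
Proof. by move=> z /[!inE] -[dz cz] /=; rewrite /lift asboolT. Qed.

Let liftW2 d g : supp_in K g -> forall z, W2 d z -> (lift c g \o chart_inv d) z = 0.
Proof.
move=> gK z [dz Cz] /=; rewrite /lift; case: asboolP => // cz; apply: gK => Kz.
by apply: Cz; exists (chart_map c (chart_inv d z)) => //; exact: chart_inv_map.
Qed.

(** In another chart d, the points of the domain of c are treated by a change of
    coordinates; the others have a neighbourhood where the lift is 0, because
    the image C of K in M is compact, hence closed. *)
Lemma smooth_lift g : smooth_on setT g -> supp_in K g -> smooth (lift c g).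
Proof.
move=> gs gK d Md; apply: smooth_on_local => z dz.
have [cz|ncz] := pselect (chart_dom c (chart_inv d z)).
  have gp := smooth_comp (@oW1 d) openT (fun _ _ => I) (psi_smooth Md) gs.
  exists (W1 d); split; [exact: oW1|by []|exact: (eq_smooth_on (@oW1 d) (@liftW1 d g) gp)].
exists (W2 d); split=> //; first by split=> // /C_dom.
apply: (eq_smooth_on (@oW2 d) _ (smooth_on_cst 0 (@oW2 d))) => y /[!inE] Wy.
by rewrite (liftW2 gK Wy).
Qed.

(** A fixed constant relates the derivatives in the chart d to those in the
    chart c: what is left of Kd after removing the open set where the lift is 0
    is a compact subset of the domain of the change of coordinates. *)
Lemma lift_jet_bound d (Kd : set 'rV[R]_n) (s : seq 'I_n) :
  mfd_atlas d -> compact Kd -> Kd `<=` chart_im d ->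
  exists2 A, 0 <= A & forall g B, smooth_on setT g -> supp_in K g ->
    dbound setT (size s) g B ->
    forall z, Kd z -> `|partials s (lift c g \o chart_inv d) z| <= A * B.
Proof.
move=> Md cKd Kdd; pose K' := Kd `&` ~` W2 d.
have cK' : compact K' by apply: compact_closedI => //; exact: open_closedC.
have K'W : K' `<=` W1 d.
  move=> z [Kz NW]; split; first exact: Kdd.
  apply: C_dom; apply: contrapT => NC; apply: NW; split=> //; exact: Kdd.
have [A0 A00 HA] : exists2 A, 0 <= A & forall ij : 'I_n * 'I_n,
    dbound K' (size s) (partial ij.1 (fun x => psi d x 0 ij.2)) A.
  apply: dbound_finite => -[i j]; apply: (compact_dbound (U := W1 d)) => //.
  exact: smooth_on_partial (psi_smooth Md j).
have [A A'0 H] := dbound_comp (@oW1 d) K'W (psi_smooth Md) A00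
  (fun i j => HA (i, j)).
exists A => // g D gs gK gD z Kz; have D0 := dbound_ge0 gD.
have [W2z|NW] := pselect (W2 d z).
  by rewrite (partials_supp0 s (@oW2 d) (liftW2 gK) W2z) normr0 mulr_ge0.
have K'z : K' z by [].
rewrite -(eq_partials s (@oW1 d) (@liftW1 d g)) ?inE; last exact: K'W.
exact: (H g D gs gD s (leqnn _) z K'z).
Qed.

End Lift.

End Charts.

(** * Convergence of smooth functions on a manifold *)

Lemma initial_cvg (S : choiceType) (T : topologicalType) (f : S -> T)
    (F : set_system S) (FF : Filter F) (s : S) :
  f @ F --> f s -> F --> (s : initial_topology f).
Proof.
move=> H A; rewrite nbhsE => -[B [[C oC <-] Bs] BA].
apply: (filterS BA); apply: H; exact: open_nbhs_nbhs.
Qed.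

Section CinftyOps.
Context {R : realType} {n : nat} (M : smooth_manifold R n).
Implicit Types (f g : Cinfty M) (x : M).

Lemma CinftyE_add f g x : (f + g) x = f x + g x.
Proof. by rewrite -[(f + g) x]/(val (f + g) x) raddfD. Qed.

Lemma CinftyE_sub f g x : (f - g) x = f x - g x.
Proof. by rewrite -[(f - g) x]/(val (f - g) x) raddfB. Qed.

Lemma CinftyE_mul f g x : (f * g) x = f x * g x.
Proof. by rewrite -[(f * g) x]/(val (f * g) x) rmorphM. Qed.

Lemma CinftyE_scale (a : R) f x : (a *: f) x = a * f x.
Proof. by rewrite -[(a *: f) x]/(val (a *: f) x) linearZ. Qed.

Lemma CinftyE_zero x : (0 : Cinfty M) x = 0.
Proof. by rewrite -[(0 : Cinfty M) x]/(val (0 : Cinfty M) x) raddf0. Qed.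

Lemma Cinfty_ext f g : f =1 g -> f = g.
Proof. by move=> fg; apply/val_inj/funext. Qed.

Lemma Cinfty_smooth f : smooth f.
Proof. exact: asboolW (valP f). Qed.

Definition Cinfty_of (F : M -> R) : Cinfty M := insubd (0 : Cinfty M) F.

Lemma Cinfty_ofE (F : M -> R) : smooth F -> Cinfty_of F = F :> (M -> R).
Proof. by move=> Fs; rewrite -[LHS]/(val (Cinfty_of F)) insubdK//; exact/asboolP. Qed.

(** The topology is that of uniform convergence of all derivatives on the
    compact subsets of charts, so it suffices to bound each of them. *)
Lemma Cinfty_cvg0 (u : nat -> Cinfty M) :
  (forall d K s, mfd_atlas d -> compact K -> K `<=` chart_im d ->
    exists2 A : R, 0 <= A & \forall m \near \oo,
      forall z, K z -> `|partials s (u m \o chart_inv d) z| <= A / m.+1%:R) ->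
  u @ \oo --> (0 : Cinfty M).
Proof.
move=> H; apply: initial_cvg; apply/cvg_sup => -[d s].
apply: initial_cvg; apply/fam_cvgP => K [cK Kd].
move=> P /uniform_nbhs [E [entE EP]].
move: d K cK Kd E entE EP => [d /= Md] K cK Kd E; rewrite -entourage_ballE => -[e /= e0 He] EP.
have [A A0 HA] := H d K s Md cK Kd.
rewrite /nbhs/=; near=> m.
have Hm z : K z -> `|partials s (u m \o chart_inv d) z| <= A / m.+1%:R.
  by move: z; near: m.
have Am : A / m.+1%:R < e.
  near: m; have k0 : 0 < e / (A + 1) by rewrite divr_gt0// ltr_wpDl.
  have := near_infty_natSinv_lt (PosNum k0); apply: filterS => m /= Hm.
  rewrite (@le_lt_trans _ _ ((A + 1) * m.+1%:R^-1))//.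
    by rewrite ler_wpM2r// lerDl.
  by rewrite -ltr_pdivlMl ?ltr_wpDl// mulrC.
apply: EP => z Kz; apply: He => /=.
rewrite /ball/= /jet/=.
have -> : partials s ((0 : Cinfty M) \o chart_inv d) z = 0.
  have E0 : (0 : Cinfty M) \o chart_inv d = (fun=> 0 : R).
    by apply/funext => y; exact: CinftyE_zero.
  by rewrite E0 partials_cst0.
by rewrite sub0r normrN (le_lt_trans (Hm z Kz) Am).
Unshelve. all: by end_near. Qed.

Lemma distribution_null (Phi : smooth_distribution M) (u : nat -> Cinfty M) (a : R) :
  u @ \oo --> (0 : Cinfty M) -> (\forall m \near \oo, Phi (u m) = a) -> a = 0.
Proof.
move=> u0 ua; have c := @distribution_continuous _ _ _ Phi (0 : Cinfty M).
have := cvg_comp _ _ u0 c; rewrite linear0 => H1.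
have H2 : (Phi \o u) @ \oo --> (a : R^o).
  by apply: cvg_near_cst; apply: filterS ua => m.
exact: (cvg_unique _ H2 H1).
Qed.

End CinftyOps.

(** * Derivations in local coordinates *)

Section ClosedBall.
Context {R : realType} {n : nat}.

Definition cball (p : 'rV[R]_n) (r : R) : set 'rV[R]_n := [set x | `|x - p| <= r].

Lemma dist_continuous (p : 'rV[R]_n) : continuous (fun x : 'rV[R]_n => `|x - p|).
Proof.
move=> x; apply: (@cvg_norm _ _ _ (nbhs x)).
by apply: (@cvgB _ _ _ (nbhs x)); [exact: cvg_id|exact: cvg_cst].
Qed.

Lemma cball_closed p r : closed (cball p r).
Proof.
have -> : cball p r = (fun x => `|x - p|) @^-1` [set z | z <= r] by [].
by apply: preimage_closed; [move=> x _; exact: dist_continuous|exact: closed_le].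
Qed.

Lemma cball_compact p r : compact (cball p r).
Proof.
apply: bounded_closed_compact; last exact: cball_closed.
exists (`|p| + r); split; first exact: num_real.
move=> B rB x xr; apply: le_trans (ltW rB).
by rewrite -[x](subrK p) (le_trans (ler_normD _ _))// addrC lerD2l.
Qed.

End ClosedBall.

Section Bumps.
Context {R : realType} {n : nat} (M : smooth_manifold R n).

Lemma chart_around (x : M) : exists2 d, mfd_atlas d & chart_dom d x.
Proof.
have : (\bigcup_(c in @mfd_atlas _ _ M) chart_dom c) x by rewrite mfd_cover.
by move=> [d Md dx]; exists d.
Qed.

Lemma cball_in (U : set 'rV[R]_n) z : open U -> U z ->
  exists2 r : R, 0 < r & cball z r `<=` U.
Proof.
rewrite openE => /(_ z)/[apply]; rewrite /interior => /nbhs_ballP[r /= r0 rU].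
exists (r / 2); first by rewrite divr_gt0.
move=> y yr; apply: rU; rewrite -ball_normE /= distrC (le_lt_trans yr)//.
by rewrite ltr_pdivrMr// mulr_natr mulr2n ltrDl.
Qed.

Lemma bump_exists (x : M) (O : set M) : open O -> O x ->
  exists2 b : Cinfty M, b x != 0 & forall y, ~ O y -> b y = 0.
Proof.
move=> oO Ox; have [d Md dx] := chart_around x.
have Wz : (chart_im d `&` chart_inv d @^-1` O) (chart_map d x).
  by split; [exact: chart_mapP|rewrite /= chart_inv_map].
have [r r0 rW] := cball_in (open_preim (d := d) oO) Wz.
set z := chart_map d x in Wz rW.
have K0 : supp_in (cball z r) (bump z r).
  move=> y ny; apply: bump_eq0 => //; rewrite leNgt; apply/negP => h; apply: ny.
  exact: ltW.
have s := smooth_lift Md (@cball_compact _ _ z r) (fun y yr => (rW y yr).1) (smooth_bump z r) K0.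
exists (Cinfty_of (lift d (bump z r))) => [|y nOy]; rewrite Cinfty_ofE// /lift.
  by rewrite asboolT// gt_eqF// bump_gt0// subrr normr0.
case: asboolP => // dy; apply: K0 => zy; apply: nOy.
by have [_ /=] := rW _ zy; rewrite chart_inv_map.
Qed.

End Bumps.

Section Derivation.
Context {R : realType} {n : nat} (M : smooth_manifold R n).
Variable D : Cinfty M -> Cinfty M.
Hypothesis D_linear : linear D.
Hypothesis D_leibniz : forall g h, D (g * h) = D g * h + g * D h.

Lemma derivation0 : D 0 = 0.
Proof.
have := D_linear (-1) 0 0; rewrite scaler0 addr0 scaleN1r => ->.
exact: addNr.
Qed.

Lemma derivationD g h : D (g + h) = D g + D h.
Proof. by have := D_linear 1 g h; rewrite !scale1r. Qed.

Lemma derivationZ (k : R) g : D (k *: g) = k *: D g.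
Proof. by have := D_linear k g 0; rewrite !addr0 derivation0 addr0. Qed.

Lemma derivationB g h : D (g - h) = D g - D h.
Proof. by rewrite -[- h]scaleN1r derivationD derivationZ scaleN1r. Qed.

Lemma derivation1 : D 1 = 0.
Proof.
have := D_leibniz 1 1; rewrite !mulr1 mul1r => /eqP.
by rewrite -subr_eq subrr eq_sym => /eqP.
Qed.

Lemma derivation_sum (I : finType) (F : I -> Cinfty M) : D (\sum_i F i) = \sum_i D (F i).
Proof. by apply: big_morph; [exact: derivationD|exact: derivation0]. Qed.

(** Multiplying g by a bump function b at x supported in O gives 0, and Leibniz'
    rule at x leaves only b x * D g x. *)
Lemma derivation_local (O : set M) (g : Cinfty M) x : open O -> O x -> (forall y, O y -> g y = 0) ->
  D g x = 0.
Proof.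
move=> oO Ox g0; have [b bx b0] := bump_exists oO Ox.
have bg : b * g = 0.
  apply: Cinfty_ext => y; rewrite CinftyE_mul CinftyE_zero.
  by have [Oy|NOy] := pselect (O y); [rewrite (g0 _ Oy) mulr0|rewrite (b0 _ NOy) mul0r].
have := D_leibniz b g; rewrite bg derivation0 => /(congr1 (fun h : Cinfty M => h x)).
rewrite CinftyE_zero CinftyE_add !CinftyE_mul (g0 _ Ox) mulr0 add0r => /esym/eqP.
by rewrite mulf_eq0 (negPf bx) => /eqP.
Qed.

Lemma derivation_eq_local (O : set M) (g h : Cinfty M) x : open O -> O x ->
  (forall y, O y -> g y = h y) -> D g x = D h x.
Proof.
move=> oO Ox gh; apply/eqP; rewrite -subr_eq0 -CinftyE_sub -derivationB; apply/eqP.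
by apply: (derivation_local oO Ox) => y Oy; rewrite CinftyE_sub gh// subrr.
Qed.

Section LocalForm.
Variables (c : chart R n M) (p : 'rV[R]_n) (r : R).
Hypotheses (Mc : mfd_atlas c) (r0 : 0 < r) (rc : cball p (2 * r) `<=` chart_im c).

Let chi := plateau p r.
Let chi_smooth : smooth_on setT chi := smooth_plateau p r0.
Let K := cball p (2 * r).
Let cK : compact K := @cball_compact _ _ p (2 * r).

Definition clift h : Cinfty M := Cinfty_of (lift c h).

Lemma cliftE h : smooth_on setT h -> supp_in K h -> clift h = lift c h :> (M -> R).
Proof. by move=> hs hK; apply: Cinfty_ofE; exact: (smooth_lift Mc cK rc hs hK). Qed.

Let chi_supp h : supp_in K (fun x => chi x * h x).
Proof.
move=> x nx; rewrite /chi plateau_eq0 ?mul0r// leNgt; apply/negP => h'.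
by apply: nx; exact: ltW.
Qed.

Let chi_near x : `|x - p| < r -> chi x = 1.
Proof. by move=> xr; apply: plateau_eq1 => //; exact: ltW. Qed.

Let chih_smooth h : smooth_on setT h -> smooth_on setT (fun x => chi x * h x).
Proof. exact: (smoothM openT chi_smooth). Qed.

Definition xi i : Cinfty M := clift (fun x => plateau p r x * x 0 i).

(** The coefficients of D in the chart, exact on the ball of radius r and cut off
    outside of it to be defined on the whole of R^n with bounded derivatives. *)
Definition coef i : 'rV[R]_n -> R :=
  zero_ext (chart_im c) (fun x => plateau p r x * (D (xi i) \o chart_inv c) x).

Lemma coef_smooth i : smooth_on setT (coef i).
Proof.
apply: (smooth_zero_ext (K := K)).
- exact: chart_im_open.
- exact: cball_closed.
- exact: rc.
- by move=> x _; exact: chi_supp.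
apply: smoothM; first exact: chart_im_open.
  exact: (smooth_on_subset (@subsetT _ _) chi_smooth).
exact: Cinfty_smooth Mc.
Qed.

Lemma coef_supp i : supp_in K (coef i).
Proof. by move=> x nx; rewrite /coef /zero_ext; case: asboolP => // _; exact: chi_supp. Qed.

Lemma coef_bounded m : exists2 A, 0 <= A & forall i, dbound setT m (coef i) A.
Proof.
apply: dbound_finite => i.
have [A HA] := compact_supp_bounded cK (coef_smooth i) (@coef_supp i) m.
by exists A => //; exact: dbound_ge0 HA.
Qed.

Lemma coef_near i z : `|z - p| < r -> coef i z = D (xi i) (chart_inv c z).
Proof.
move=> zr; rewrite /coef /zero_ext asboolT; first by rewrite -/chi (chi_near zr) mul1r.
apply: rc; rewrite /cball/= ltW// (lt_le_trans zr)//.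
by rewrite mulr_natl mulr2n lerDl ltW.
Qed.

Let O := chart_dom c `&` chart_map c @^-1` [set z | `|z - p| < r].

Let oO : open O.
Proof.
apply: open_chart_preim.
have -> : [set z | `|z - p| < r] = (fun x => `|x - p|) @^-1` [set z | z < r] by [].
by apply: open_comp; [move=> x _; exact: dist_continuous|exact: open_lt].
Qed.

Lemma xi_near i y : O y -> xi i y = chart_map c y 0 i.
Proof.
move=> [cy yr]; rewrite /xi cliftE; last 2 first.
- exact: (chih_smooth (smooth_coord i openT)).
- exact: chi_supp.
by rewrite /lift asboolT// -/chi (chi_near yr) mul1r.
Qed.

(** Hadamard's lemma at z writes h as h z + \sum_i (x_i - z_i) H_i with H_i z
    the partial derivatives of h at z.  Cut off by the plateau this becomes an
    identity between functions on M, valid near the point considered, to which D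
    applies by locality.  In D of the products only the terms D (x_i) H_i
    survive, as x_i - z_i vanishes at z. *)
Lemma derivation_local_form h z : smooth_on setT h -> supp_in K h ->
  `|z - p| < r -> D (clift h) (chart_inv c z) = along coef h z.
Proof.
move=> hs hK zr.
have hb := compact_supp_bounded cK hs hK.
have [H [Hs Hz HE]] := hadamard z hs hb.
have [omega onear] : exists om : Cinfty M, forall y, O y -> om y = 1.
  exists (clift (fun x => chi x * 1)) => y [cy yr]; rewrite cliftE; last 2 first.
  - exact: (chih_smooth (smooth_on_cst 1 openT)).
  - exact: chi_supp.
  by rewrite /lift asboolT// (chi_near yr) mul1r.
have [eta enear] : exists eta : 'I_n -> Cinfty M,
    forall i y, O y -> eta i y = H i (chart_map c y).
  exists (fun i => clift (fun x => chi x * H i x)) => i y [cy yr].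
  rewrite cliftE; last 2 first.
  - exact: (chih_smooth (Hs i)).
  - exact: chi_supp.
  by rewrite /lift asboolT// (chi_near yr) mul1r.
have cz : chart_im c z.
  apply: rc; rewrite /cball/= ltW// (lt_le_trans zr)//.
  by rewrite mulr_natl mulr2n lerDl ltW.
have Ox : O (chart_inv c z) by split; [exact: chart_inv_dom|rewrite /= chart_invK].
have sumE (F : 'I_n -> Cinfty M) y : (\sum_i F i) y = \sum_i F i y.
  elim/big_rec2: _ => [|i u v _ <-]; first exact: CinftyE_zero.
  exact: CinftyE_add.
have [X Xnear Xcoef] : exists2 X : 'I_n -> Cinfty M,
    forall i y, O y -> X i y = chart_map c y 0 i &
    forall i, D (X i) (chart_inv c z) = coef i z.
  by exists xi => i; [exact: xi_near|rewrite coef_near].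
pose u i := X i - z 0 i *: omega.
have uE i y : u i y = X i y - z 0 i * omega y.
  by rewrite (CinftyE_sub (X i) (z 0 i *: omega)) (CinftyE_scale (z 0 i) omega).
pose rhs := h z *: omega + \sum_i u i * eta i.
have E y : O y -> clift h y = rhs y.
  move=> Oy; have [cy yr] := Oy; rewrite (cliftE hs hK) /lift (asboolT cy) HE.
  rewrite (CinftyE_add (h z *: omega)) (CinftyE_scale (h z) omega) (onear y Oy) mulr1.
  congr (_ + _); rewrite sumE; apply: eq_bigr => i _.
  by rewrite (CinftyE_mul (u i) (eta i)) uE (onear y Oy) (mulr1 (z 0 i))
    (enear i y Oy) (Xnear i y Oy).
rewrite (derivation_eq_local oO Ox E) derivationD derivationZ derivation_sum.
rewrite (CinftyE_add (h z *: D omega)) (CinftyE_scale (h z)).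
have Dom : D omega (chart_inv c z) = 0.
  by rewrite (derivation_eq_local (h := 1) oO Ox onear) derivation1 CinftyE_zero.
have DuE i : D (u i) (chart_inv c z) = D (X i) (chart_inv c z).
  rewrite /u derivationB derivationZ (CinftyE_sub (D (X i)) (z 0 i *: D omega)).
  by rewrite (CinftyE_scale (z 0 i) (D omega)) Dom (mulr0 (z 0 i)) (subr0 (D (X i) _)).
rewrite Dom mulr0 add0r sumE /along; apply: eq_bigr => i _.
rewrite D_leibniz (CinftyE_add (D (u i) * eta i) (u i * D (eta i))).
rewrite (CinftyE_mul (D (u i)) (eta i)) (CinftyE_mul (u i) (D (eta i))) DuE uE.
rewrite (onear _ Ox) (mulr1 (z 0 i)) (Xnear i _ Ox) (chart_invK cz) (subrr (z 0 i)).
rewrite (mul0r (D (eta i) _)) (addr0 (D (X i) _ * eta i _)).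
by rewrite (enear i _ Ox) (chart_invK cz) Hz Xcoef.
Qed.

(** On the ball of radius r the local form applies.  A point outside of it has a
    neighbourhood that does not meet the support of h, so that both sides vanish
    there, the left-hand one by locality. *)
Lemma derivation_clift h r' : r' < r -> smooth_on setT h -> supp_in (cball p r') h ->
  D (clift h) = clift (along coef h).
Proof.
move=> rr hs hK'.
have hK : supp_in K h.
  move=> x nx; apply: hK' => xr; apply: nx; rewrite /K /cball/=.
  by rewrite (le_trans xr)// (le_trans (ltW rr))// mulr_natl mulr2n lerDl ltW.
have as' : smooth_on setT (along coef h) := smooth_along coef_smooth hs.
have aK' : supp_in (cball p r') (along coef h).
  move=> x nx; apply: big1 => i _.
  have oK := closed_openC (@cball_closed _ _ p r').
  have -> : partial i h x = 0 by exact: (partials_supp0 [:: i] oK hK' nx).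
  by rewrite mulr0.
have aK : supp_in K (along coef h).
  by move=> x nx; apply: big1 => i _; rewrite (coef_supp _ nx) mul0r.
apply: Cinfty_ext => x; rewrite (cliftE as' aK).
have [Ox|NOx] := pselect (O x).
  have [cx xr] := Ox; rewrite /lift asboolT//.
  by rewrite -(derivation_local_form hs hK xr) chart_inv_map.
have cC : closed (chart_inv c @` cball p r').
  apply: (compact_closed (@mfd_hausdorff _ _ M)).
  apply: continuous_compact; last exact: cball_compact.
  apply: continuous_in_subspaceT => z /[!inE] Kz.
  apply: chart_inv_continuous; rewrite inE; apply: rc.
  by rewrite /cball/= (le_trans Kz)// (le_trans (ltW rr))// mulr_natl mulr2n lerDl ltW.
have KO z : cball p r' z -> O (chart_inv c z).
  move=> Kz; have cz : chart_im c z.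
    apply: rc; rewrite /cball/= (le_trans Kz)// (le_trans (ltW rr))//.
    by rewrite mulr_natl mulr2n lerDl ltW.
  split; first exact: chart_inv_dom.
  by rewrite /= chart_invK//= (le_lt_trans Kz).
have NC : (~` (chart_inv c @` cball p r')) x by
  move=> [z Kz zx]; apply: NOx; rewrite -zx; exact: KO.
rewrite (derivation_local (closed_openC cC) NC).
  rewrite /lift; case: asboolP => // cx; rewrite aK'// => Kx; apply: NC.
  by exists (chart_map c x) => //; exact: chart_inv_map.
move=> y NCy; rewrite cliftE// /lift; case: asboolP => // cy; rewrite hK'// => Ky; apply: NCy.
by exists (chart_map c y) => //; exact: chart_inv_map.
Qed.

End LocalForm.

End Derivation.

(** * Transport of the support along integral curves *)

Section Transport.
Context {R : realType} {n : nat} (M : poisson_manifold R n).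
Variables (Phi : smooth_distribution M) (f : Cinfty M).
Hypothesis Phi_f : forall g, Phi (bracket f g) = 0.

Let D : Cinfty M -> Cinfty M := bracket f.
Let D_linear : linear D. Proof. exact: bracket_linear. Qed.
Let D_leibniz g h : D (g * h) = D g * h + g * D h. Proof. exact: bracket_leibniz. Qed.

Let telescope (u v w : R) : (u - w) + (v - u) = v - w.
Proof. by rewrite addrC addrA subrK. Qed.

Lemma Phi_sub (u v : Cinfty M) : Phi (u - v) = Phi u - Phi v.
Proof. exact: linearB. Qed.

Lemma Phi_add (u v : Cinfty M) : Phi (u + v) = Phi u + Phi v.
Proof. exact: linearD. Qed.

Lemma Phi_combination (t : R) (u v w : Cinfty M) : Phi w = 0 ->
  Phi (u - v - t *: w) = Phi u - Phi v.
Proof.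
move=> w0; have E : Phi (t *: w) = t * Phi w by exact: linearZ.
by rewrite (Phi_sub (u - v)) (Phi_sub u) E w0 (mulr0 t) (subr0 (_ - _)).
Qed.

Section InChart.
Variables (c : chart R n M) (p : 'rV[R]_n) (r : R).
Hypotheses (Mc : mfd_atlas c) (r0 : 0 < r) (rc : cball p (2 * r) `<=` chart_im c).

Let a := coef D c p r.
Let a_smooth : forall i, smooth_on setT (a i) := coef_smooth D Mc r0 rc.
Let a_bounded : forall m, exists2 A, 0 <= A & forall i, dbound setT m (a i) A :=
  coef_bounded D Mc r0 rc.
Let a_supp i : supp_in (cball p (2 * r)) (a i). Proof. exact: coef_supp. Qed.
Let L := clift c : ('rV[R]_n -> R) -> Cinfty M.

Let L_lift h : smooth_on setT h -> supp_in (cball p (2 * r)) h -> L h = lift c h :> (M -> R).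
Proof. exact: cliftE. Qed.

Let L_val x h : smooth_on setT h -> supp_in (cball p (2 * r)) h -> L h x = lift c h x.
Proof. by move=> hs hK; rewrite (L_lift hs hK). Qed.

Lemma Phi_along h r' : r' < r -> smooth_on setT h -> supp_in (cball p r') h ->
  Phi (L (along a h)) = 0.
Proof.
move=> rr hs hK; rewrite /L /a -(derivation_clift D_linear D_leibniz Mc r0 rc rr hs hK).
exact: Phi_f.
Qed.

Lemma Phi_step t g1 g2 r' : r' < r -> smooth_on setT g1 -> smooth_on setT g2 ->
  supp_in (cball p r') g1 -> supp_in (cball p r') g2 ->
  [/\ smooth_on setT (fun x => g2 x - g1 x - t * along a g1 x),
      supp_in (cball p (2 * r)) (fun x => g2 x - g1 x - t * along a g1 x) &
      Phi (L (fun x => g2 x - g1 x - t * along a g1 x)) = Phi (L g2) - Phi (L g1)].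
Proof.
move=> rr s1 s2 k1 k2.
have sa := smooth_along a_smooth s1.
have K h : supp_in (cball p r') h -> supp_in (cball p (2 * r)) h.
  move=> hk x nx; apply: hk => xr; apply: nx; rewrite /cball/=.
  by rewrite (le_trans xr)// (le_trans (ltW rr))// mulr_natl mulr2n lerDl ltW.
have K1 := K _ k1; have K2 := K _ k2.
have Ka : supp_in (cball p (2 * r)) (along a g1).
  by move=> x nx; apply: big1 => i _; rewrite (a_supp i nx) mul0r.
have ss := smoothB openT (smoothB openT s2 s1) (smoothM openT (smooth_on_cst t openT) sa).
have sK : supp_in (cball p (2 * r)) (fun x => g2 x - g1 x - t * along a g1 x).
  by move=> x nx; rewrite K1// K2// Ka// mulr0 !subr0.
split=> //.
have -> : L (fun x => g2 x - g1 x - t * along a g1 x) = L g2 - L g1 - t *: L (along a g1).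
  apply: Cinfty_ext => x.
  rewrite (CinftyE_sub (L g2 - L g1)) (CinftyE_sub (L g2)) (CinftyE_scale t).
  apply: (etrans (L_val x ss sK)); apply: esym.
  apply: (etrans (congr2 (fun u v : R => u - v)
    (congr2 (fun u v : R => u - v) (L_val x s2 K2) (L_val x s1 K1))
    (congr1 (fun u : R => t * u) (L_val x sa Ka)))).
  by rewrite /lift; case: asboolP => // _; rewrite (mulr0 t) !subr0.
exact: (Phi_combination t (L g2) (L g1) (Phi_along rr s1 k1)).
Qed.

Lemma Phi_scheme t m g r' : r' < r -> smooth_on setT g ->
  (forall j, (j <= m)%N -> supp_in (cball p r') (pullback a t j g)) ->
  [/\ smooth_on setT (scheme_defect a t m g),
      supp_in (cball p (2 * r)) (scheme_defect a t m g) &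
      Phi (L (scheme_defect a t m g)) = Phi (L (pullback a t m g)) - Phi (L g)].
Proof.
move=> rr gs; elim: m => [|m IH] gK.
  have -> : scheme_defect a t 0 g = fun=> 0.
    by apply/funext => x; rewrite /scheme_defect big_ord0.
  split; [exact: smooth_on_cst openT|by []|].
  rewrite subrr; have -> : L (fun=> 0) = 0.
    apply: Cinfty_ext => x; rewrite CinftyE_zero.
    have z0 : supp_in (cball p (2 * r)) (fun=> 0 : R) by [].
    apply: (etrans (L_val x (smooth_on_cst 0 openT) z0)).
    by rewrite /lift; case: asboolP.
  exact: linear0.
have [s1 k1 e1] := IH (fun j jm => gK j (leqW jm)).
have pm := smooth_pullback a_smooth t m gs.
have pm1 := smooth_pullback a_smooth t m.+1 gs.
have [s2 k2 e2] := Phi_step t rr pm pm1 (gK m (leqnSn m)) (gK m.+1 (leqnn _)).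
have E : scheme_defect a t m.+1 g = fun x => scheme_defect a t m g x +
    (pullback a t m.+1 g x - pullback a t m g x - t * along a (pullback a t m g) x).
  by apply/funext => x; rewrite /scheme_defect big_ord_recr.
rewrite E; split.
- exact: (smoothD openT s1 s2).
- by move=> x nx; rewrite (k1 x nx) (k2 x nx) addr0.
have -> : L (fun x => scheme_defect a t m g x +
    (pullback a t m.+1 g x - pullback a t m g x - t * along a (pullback a t m g) x)) =
  L (scheme_defect a t m g) +
  L (fun x => pullback a t m.+1 g x - pullback a t m g x - t * along a (pullback a t m g) x).
  have ss := smoothD openT s1 s2.
  have sk : supp_in (cball p (2 * r)) (fun x => scheme_defect a t m g x +
      (pullback a t m.+1 g x - pullback a t m g x - t * along a (pullback a t m g) x)).
    by move=> y ny; rewrite (k1 y ny) (k2 y ny) addr0.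
  apply: Cinfty_ext => x.
  rewrite (CinftyE_add (L (scheme_defect a t m g))).
  apply: (etrans (L_val x ss sk)); apply: esym.
  apply: (etrans (congr2 (fun u v : R => u + v) (L_val x s1 k1) (L_val x s2 k2))).
  by rewrite /lift; case: asboolP => // _; rewrite addr0.
apply: (etrans (Phi_add _ _)); apply: (etrans (congr2 (fun u v : R => u + v) e1 e2)).
exact: telescope.
Qed.

Variables (y : R -> 'rV[R]_n) (t0 e : R).
Hypothesis y_curve : forall t, `|t - t0| < e ->
  forall i, is_derive t 1 (fun s => y s 0 i) (a i (y t)).
Hypothesis y_near : forall t, `|t - t0| < e -> `|y t - p| <= r / 2.

(** Let g be supported within delta of y s.  By [euler_tracking] its iterated
    pullbacks stay within the part of the chart where the coefficients are
    exact, and the last one is supported in the open set around y t on which Phi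
    vanishes.  So Phi g is minus the value of Phi on the scheme defect, which
    tends to 0. *)
Lemma transport_in_chart s t : `|s - t0| < e -> `|t - t0| < e ->
  ~ Supp Phi (chart_inv c (y t)) -> ~ Supp Phi (chart_inv c (y s)).
Proof.
move=> se te.
have sub2r u : `|u - p| <= r -> chart_im c u.
  by move=> ur; apply: rc; rewrite /cball/= (le_trans ur)// mulr_natl mulr2n lerDl ltW.
have y_im u : `|u - t0| < e -> chart_im c (y u).
  move=> ue; apply: sub2r; rewrite (le_trans (y_near ue))//.
  by rewrite ler_pdivrMr// mulr_natr mulr2n lerDl ltW.
move=> /contrapT[U [oU Uyt PhiU]] Supp_s; apply: Supp_s.
have Wt : (chart_im c `&` chart_inv c @^-1` U) (y t) by split; [exact: y_im|].
have [rho1 rho10 rhoW] := cball_in (open_preim (d := c) oU) Wt.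
pose rho := Num.min rho1 (r / 4).
have rho0 : 0 < rho by rewrite lt_min rho10 divr_gt0.
have rhor : rho <= r / 4 by rewrite ge_min lexx orbT.
have rhor1 : rho <= rho1 by rewrite ge_min lexx.
have [C [C0 HC]] := euler_tracking a_smooth a_bounded y_curve.
pose T := s - t; pose Q := expR (C * `|T|).
have Q0 : 0 < Q by exact: expR_gt0.
have Q1 : 1 <= Q by rewrite -expR0 ler_expR mulr_ge0.
(* half of rho absorbs delta, amplified by Q, and half the consistency error *)
pose delta := rho / (2 * Q).
have d0 : 0 < delta by rewrite divr_gt0// mulr_gt0.
have drho : delta <= rho / 2.
  by rewrite /delta ler_pM2l// lef_pV2 ?posrE ?mulr_gt0// ler_peMr.
(* the curve stays within r / 2 of p and rho is at most r / 4, so these bounds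
   keep the supports of all iterates inside the ball of radius 3 r / 4 *)
have track : \forall m \near \oo, forall j, (j <= m.+1)%N -> forall x,
    `|iter j (euler a (T / m.+1%:R)) x - y s| <= delta ->
    `|x - y (s - j%:R * (T / m.+1%:R))| <= rho /\ `|s - j%:R * (T / m.+1%:R) - t0| < e.
  (* w / (m + 1) bounds both C |u| and the amplified consistency error *)
  pose w := (C * `|T| + Q * (C * `|T| ^+ 2)).
  have w0 : 0 <= w.
    by rewrite addr_ge0 ?mulr_ge0 ?(ltW Q0)// exprn_ge0.
  have k0 : 0 < Num.min 1 (rho / 2) / (w + 1).
    by rewrite divr_gt0 ?ltr_wpDl// lt_min ltr01 divr_gt0.
  have := near_infty_natSinv_lt (PosNum k0); apply: filterS => m /= Hm j jm x xd.
  set u := T / m.+1%:R in xd *.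
  have m0 : 0 < m.+1%:R :> R by [].
  have ju : j%:R * `|u| <= `|T|.
    rewrite /u normrM normfV normr_nat mulrCA ler_piMr// ler_pdivrMr// mul1r.
    by rewrite ler_nat.
  have wm : w / m.+1%:R <= Num.min 1 (rho / 2).
    move: Hm; rewrite ltr_pdivlMr ?ltr_wpDl// => /ltW; apply: le_trans.
    by rewrite mulrC ler_wpM2l ?invr_ge0 ?ler0n// lerDl.
  have uE : `|u| = `|T| / m.+1%:R by rewrite /u normrM normfV normr_nat.
  have Cu : C * `|u| <= 1.
    apply: le_trans (le_trans wm _); last by rewrite ge_min lexx.
    rewrite uE mulrA ler_wpM2r ?invr_ge0 ?ler0n// /w lerDl.
    by rewrite !mulr_ge0 ?(ltW Q0)// exprn_ge0.
  have conv k : (k <= m.+1)%N -> `|s - k%:R * u - t0| < e.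
    move=> km; pose l : R := k%:R / m.+1%:R.
    have l0 : 0 <= l by rewrite divr_ge0.
    have l1 : l <= 1 by rewrite ler_pdivrMr// mul1r ler_nat.
    have -> : s - k%:R * u - t0 = (1 - l) * (s - t0) + l * (t - t0).
      by rewrite /u /T /l; field; rewrite addrC natr1 pnatr_eq0.
    rewrite (le_lt_trans (ler_normD _ _))// (normrM (1 - l)) (normrM l) (ger0_norm l0).
    rewrite (@ger0_norm _ (1 - l)) ?subr_ge0//.
    move: se te; move: `|_| => A; move: `|_| => B Ae Be.
    have [->|lN0] := eqVneq l 0; first by rewrite subr0 mul1r mul0r addr0.
    have lp : 0 < l by rewrite lt_neqAle eq_sym lN0.
    have -> : e = (1 - l) * e + l * e by ring.
    apply: ler_ltD; last by rewrite ltr_pM2l.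
    by rewrite ler_wpM2l ?subr_ge0// ltW.
  split; last exact: conv.
  have := HC u Cu j x s (fun k kj => conv k (leq_trans kj jm)).
  move=> /le_trans; apply.
  apply: (@le_trans _ _ (Q * (delta + C * (`|T| * `|u|)))).
    apply: ler_pM; rewrite ?expR_ge0// ?addr_ge0 ?mulr_ge0// ?exprn_ge0//.
      by rewrite ler_expR ler_wpM2l.
    apply: lerD => //; rewrite ler_wpM2l// expr2 mulrA.
    by rewrite ler_wpM2r.
  rewrite mulrDr [rho]splitr; apply: lerD.
    rewrite /delta invfM mulrCA [Q * _]mulrCA divff ?gt_eqF// mulr1.
    by [].
  apply: le_trans (le_trans wm _); last by rewrite ge_min lexx orbT.
  rewrite uE; have -> : Q * (C * (`|T| * (`|T| / m.+1%:R))) = Q * (C * `|T| ^+ 2) / m.+1%:R by ring.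
  by rewrite ler_wpM2r ?invr_ge0 ?ler0n// /w lerDr mulr_ge0.
pose r' := 3 / 4 * r.
have rr : r' < r by rewrite /r' gtr_pMl// ltr_pdivrMr// mul1r ltr_nat.
have y_rho u x : `|u - t0| < e -> `|x - y u| <= rho -> `|x - p| <= r'.
  move=> ue xr; rewrite -[x](subrK (y u)) -addrA (le_trans (ler_normD _ _))//.
  apply: (le_trans (lerD xr (y_near ue))); apply: (le_trans (lerD rhor (lexx _))).
  by rewrite le_eqVlt; apply/orP; left; apply/eqP; rewrite /r'; field.
exists (chart_dom c `&` chart_map c @^-1` [set z | `|z - y s| < delta]); split.
- apply: open_chart_preim.
  have -> : [set z | `|z - y s| < delta] = (fun x => `|x - y s|) @^-1` [set z | z < delta] by [].
  by apply: open_comp; [move=> x _; exact: dist_continuous|exact: open_lt].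
- split; first exact: chart_inv_dom (y_im s se).
  by rewrite /= chart_invK ?subrr ?normr0//; exact: y_im.
move=> g g0.
pose g1 : 'rV[R]_n -> R := zero_ext (chart_im c) (g \o chart_inv c).
have dr : cball (y s) delta `<=` cball p r'.
  move=> x xd; apply: (y_rho s) => //; rewrite (le_trans xd)// (le_trans drho)//.
  by rewrite ler_pdivrMr// mulr_natr mulr2n lerDl ltW.
have dim : cball (y s) delta `<=` chart_im c.
  by move=> x /dr xr; apply: sub2r; rewrite (le_trans xr)// ltW.
have g_off x : chart_im c x -> ~ cball (y s) delta x -> (g \o chart_inv c) x = 0.
  move=> cx nx; apply: g0 => -[_]; rewrite /= chart_invK// => /ltW; exact: nx.
have g1s : smooth_on setT g1.
  apply: (smooth_zero_ext _ (@cball_closed _ _ (y s) delta) dim g_off).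
    exact: chart_im_open.
  exact: Cinfty_smooth Mc.
have g1K : supp_in (cball (y s) delta) g1.
  by move=> x nx; rewrite /g1 /zero_ext; case: asboolP => // cx; exact: g_off.
have g1K2 : supp_in (cball p (2 * r)) g1.
  move=> x nx; apply: g1K => /dr xr; apply: nx; rewrite /cball/=.
  by rewrite (le_trans xr)// (le_trans (ltW rr))// mulr_natl mulr2n lerDl ltW.
have gE : L g1 = g.
  apply: Cinfty_ext => x; rewrite (L_lift g1s g1K2) /lift; case: asboolP => cx.
    by rewrite /g1 /zero_ext (asboolT (chart_mapP cx)) /= (chart_inv_map cx).
  by rewrite g0// => -[].
have g1b := compact_supp_bounded (@cball_compact _ _ (y s) delta) g1s g1K.
pose u m := L (scheme_defect a (T / m.+1%:R) m.+1 g1).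
have good : \forall m \near \oo,
   [/\ smooth_on setT (scheme_defect a (T / m.+1%:R) m.+1 g1),
      supp_in (cball p (2 * r)) (scheme_defect a (T / m.+1%:R) m.+1 g1) &
      Phi (u m) = - Phi g].
  apply: filterS track => m tr.
  have K j : (j <= m.+1)%N -> supp_in (cball p r') (pullback a (T / m.+1%:R) j g1).
    move=> jm x nx; apply: g1K => xd; apply: nx.
    by have [h1 h2] := tr j jm x xd; exact: (y_rho _ _ h2 h1).
  have [h1 h2 h3] := Phi_scheme rr g1s K; split=> //.
  rewrite /u h3 gE (_ : Phi _ = 0) ?sub0r//; apply: PhiU => x nUx.
  have ps := smooth_pullback a_smooth (T / m.+1%:R) m.+1 g1s.
  have pK : supp_in (cball p (2 * r)) (pullback a (T / m.+1%:R) m.+1 g1).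
    move=> z nz; apply: (K m.+1 (leqnn _)) => zr; apply: nz; rewrite /cball/=.
    by rewrite (le_trans zr)// (le_trans (ltW rr))// mulr_natl mulr2n lerDl ltW.
  rewrite (L_lift ps pK) /lift; case: asboolP => // cx.
  apply: g1K => xd; apply: nUx.
  have [h4 _] := tr m.+1 (leqnn _) _ xd.
  have inb : cball (y t) rho1 (chart_map c x).
    rewrite /cball/=; move: h4; rewrite mulrC divfK ?pnatr_eq0//.
    by rewrite /T opprB addrCA subrr addr0 => /le_trans; exact.
  by have [_] := rhoW _ inb; rewrite /= (chart_inv_map cx).
have ulim : u @ \oo --> (0 : Cinfty M).
  apply: Cinfty_cvg0 => d K sq Md cK Kd.
  have [A A0 HA] := lift_jet_bound Mc (@cball_compact _ _ p (2 * r)) rc sq Md cK Kd.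
  have [B HB] := g1b (size sq).+3.
  have [E E0 HE] := scheme_defect_bound a_smooth a_bounded T g1s HB.
  exists (A * E); first by rewrite mulr_ge0.
  have NT : \forall m \near \oo, `|T| <= m.+1%:R :> R.
    have k0 : 0 < (`|T| + 1)^-1 by rewrite invr_gt0 ltr_wpDl.
    have := near_infty_natSinv_lt (PosNum k0); apply: filterS => m /= /ltW.
    rewrite lef_pV2 ?posrE ?ltr_wpDl// => /(le_trans _); apply.
    by rewrite lerDl.
  near=> m => z Kz.
  have [h1 h2 _] : [/\ smooth_on setT (scheme_defect a (T / m.+1%:R) m.+1 g1),
      supp_in (cball p (2 * r)) (scheme_defect a (T / m.+1%:R) m.+1 g1) &
      Phi (u m) = - Phi g] by near: m.
  have Tm : `|T| <= m.+1%:R :> R by near: m.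
  rewrite /u (L_lift h1 h2) -mulrA; exact: (HA _ _ h1 h2 (HE m Tm) z Kz).
have H := @distribution_null _ _ _ Phi u (- Phi g) ulim.
apply/eqP; rewrite -oppr_eq0; apply/eqP; apply: H.
by apply: filterS good => m [].
Unshelve. all: by end_near. Qed.

End InChart.

End Transport.

Section Curves.
Context {R : realType} {n : nat} (M : poisson_manifold R n).
Variable Phi : smooth_distribution M.
Hypothesis Phi_center : generalized_center Phi.

Lemma center_bracket f g : Phi (bracket f g) = 0.
Proof.
have := Phi_center f => /(congr1 (fun h : Cinfty M -> R => h g)).
by rewrite /bracket_distribution/= => /eqP; rewrite oppr_eq0 => /eqP.
Qed.

(** Near t0 the curve runs in one chart, where its coordinates solve the
    differential equation with coefficients coef: test the curve against the
    cut-off coordinate functions. *)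
Lemma Supp_locally_constant (f : Cinfty M) (a b : R) (gamma : R -> M) (t0 : R) :
  integral_curve f a b gamma -> t0 \in `]a, b[ ->
  exists2 e, 0 < e & forall s t, `|s - t0| < e -> `|t - t0| < e ->
    ~ Supp Phi (gamma t) -> ~ Supp Phi (gamma s).
Proof.
move=> gc t0ab; have [c Mc cx] := chart_around (gamma t0).
have [r1 r10 r1c] := cball_in (@chart_im_open _ _ _ c) (chart_mapP cx).
set p := chart_map c (gamma t0) in r1c.
pose r := r1 / 2; have r0 : 0 < r by rewrite divr_gt0.
have rc : cball p (2 * r) `<=` chart_im c by rewrite /r mulrC divfK.
have rr : r / 2 < r by rewrite gtr_pMr// invf_lt1// ltr1n.
pose O := chart_dom c `&` chart_map c @^-1` [set z | `|z - p| < r / 2].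
have oO : open O.
  apply: open_chart_preim.
  have -> : [set z | `|z - p| < r / 2] = (fun x => `|x - p|) @^-1` [set z | z < r / 2] by [].
  by apply: open_comp; [move=> x _; exact: dist_continuous|exact: open_lt].
have Ot0 : O (gamma t0) by split=> //=; rewrite subrr normr0 divr_gt0.
have [gcont _] := gc t0 t0ab.
have : \forall t \near t0, O (gamma t) /\ (t \in `]a, b[).
  near=> t; split; near: t.
    by apply: gcont; exact: open_nbhs_nbhs.
  exact: near_in_itvoo.
move=> /nbhs_ballP[e /= e0 He].
have ne t : `|t - t0| < e -> O (gamma t) /\ (t \in `]a, b[).
  by move=> te; apply: He; rewrite -ball_normE /= distrC.
exists e => // s t se te.
pose y u := chart_map c (gamma u).
have yE u : `|u - t0| < e -> chart_inv c (y u) = gamma u.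
  by move=> /ne[[cu _] _]; exact: chart_inv_map.
rewrite -(yE s se) -(yE t te).
apply: (transport_in_chart (center_bracket f) Mc r0 rc (t0 := t0) (e := e)) => //.
  move=> u ue i; have [[cu ru] uab] := ne u ue.
  have [_ /(_ (xi c p r i)) d] := gc u uab.
  rewrite (coef_near _ r0 rc); last exact: lt_trans rr.
  rewrite (yE u ue).
  apply: near_eq_is_derive d.
  have Nu : \forall v \near u, `|v - t0| < e.
    have o : open [set v | `|v - t0| < e].
      have -> : [set v | `|v - t0| < e] = (fun x => `|x - t0|) @^-1` [set z | z < e] by [].
      apply: open_comp; last exact: open_lt.
      by move=> x _; apply: cvg_norm; apply: cvgB; [exact: cvg_id|exact: cvg_cst].
    exact: open_nbhs_nbhs.
  apply: filterS Nu => v ve; have [[cv rv] _] := ne v ve.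
  rewrite /= (xi_near Mc r0 rc)//; split=> //=; exact: lt_trans rr.
by move=> u /ne[[_ /ltW]].
Unshelve. all: by end_near. Qed.

(** By local constancy, the parameters of points in the support and those of
    points outside of it form two open sets; the interval is connected. *)
Lemma Supp_integral_curve (f : Cinfty M) (a b : R) (gamma : R -> M) (s t : R) :
  integral_curve f a b gamma -> s \in `]a, b[ -> t \in `]a, b[ ->
  ~ Supp Phi (gamma t) -> ~ Supp Phi (gamma s).
Proof.
move=> gc sab tab Nt.
pose I : set R := `]a, b[%classic.
pose B : set R := [set u | (u \in `]a, b[) /\ (~ Supp Phi (gamma u))].
pose B' : set R := [set u | (u \in `]a, b[) /\ Supp Phi (gamma u)].
have nb u : (u \in `]a, b[) -> exists2 e, 0 < e & forall v, `|v - u| < e ->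
    (v \in `]a, b[) /\ (Supp Phi (gamma v) <-> Supp Phi (gamma u)).
  move=> uab; have [e e0 He] := Supp_locally_constant gc uab.
  have : \forall v \near u, `|v - u| < e /\ (v \in `]a, b[).
    near=> v; split; near: v; last exact: near_in_itvoo.
    by apply/nbhs_ballP; exists e => // v; rewrite -ball_normE /= distrC.
  move=> /nbhs_ballP[d /= d0 Hd]; exists d => // v vd.
  have [ve vab] : `|v - u| < e /\ (v \in `]a, b[).
    by apply: Hd; rewrite -ball_normE /= distrC.
  have ue : `|u - u| < e by rewrite subrr normr0.
  split=> //; split=> H; apply: contrapT => N.
    exact: (He _ _ ve ue N).
  exact: (He _ _ ue ve N).
have oB : open B.
  rewrite openE => u [uab Nu]; have [e e0 He] := nb u uab.
  apply/nbhs_ballP; exists e => // v; rewrite -ball_normE /= distrC => ve.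
  by have [vab E] := He v ve; split=> // /E.
have oB' : open B'.
  rewrite openE => u [uab Nu]; have [e e0 He] := nb u uab.
  apply/nbhs_ballP; exists e => // v; rewrite -ball_normE /= distrC => ve.
  by have [vab E] := He v ve; split=> //; apply/E.
have cI : connected I by apply/connected_intervalP; exact: interval_is_interval.
have BI : B = I.
  apply: cI.
  - by exists t; split.
  - exists B => //; apply/seteqP; split=> u; last by case.
    by move=> Bu; split=> //; case: Bu.
  - exists (~` B'); first exact: open_closedC.
    apply/seteqP; split=> u.
      by move=> [uab Nu]; split=> // -[].
    by move=> [uab Nu]; split=> // Su; apply: Nu.
have : I s by [].
by rewrite -BI => -[].
Unshelve. all: by end_near. Qed.

Lemma Supp_hamiltonian_path (x y : M) : hamiltonian_path x y ->
  Supp Phi x <-> Supp Phi y.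
Proof.
move=> [f [a [b [gamma [s [t [gc sab tab <- <-]]]]]]]; split=> H.
  apply: contrapT => N; exact: (Supp_integral_curve gc sab tab N).
apply: contrapT => N; exact: (Supp_integral_curve gc tab sab N).
Qed.

Lemma Supp_leaf (x y : M) : clos_refl_trans M (@hamiltonian_path _ _ M) x y ->
  Supp Phi x <-> Supp Phi y.
Proof.
elim=> [u v|u|u v w _ IH1 _ IH2]; [exact: Supp_hamiltonian_path|by []|].
by split=> [/IH1/IH2|/IH2/IH1].
Qed.

End Curves.

Theorem corollary8p8 (R : realType) (n : nat) (M : poisson_manifold R n)
    (M_compact : compact [set: M])
    (Phi : smooth_distribution M) (Phi_center : generalized_center Phi)
    (N : set M) (N_leaf : symplectic_leaf N)
    (N_compact : compact N) (N_closed : closed N) :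
  N `&` Supp Phi !=set0 -> N `<=` Supp Phi.
Proof.
case: N_leaf => x ->{N N_compact N_closed} [z [xz Sz]] w xw.
exact/(Supp_leaf Phi_center xw)/(Supp_leaf Phi_center xz).
Qed.
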